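(* There is a universal constant $C$ such that the following holds for all $n,m\ge1$, $\epsilon\in(0,1/2)$ and $\delta\in(0,1)$. If $k\ge \frac{C}{\epsilon^2}\left(m^2+m\log n+\log(1/\delta)\right)$, then there is a procedure that maps $k$ valuation profiles (of $n$ valuations on $[m]$ each) to a price vector in $\mathbb{R}_{\ge0}^m$ such that, for every generic distribution $D$ over profiles of $n$ valuations on $[m]$, when the input profiles are $k$ independent samples from $D$, the output is, with probability at least $1-\delta$, a vector of $(\frac12-\epsilon)$-median prices for $D$.
   Context: Valuations are functions $v:2^{[m]}\to\mathbb{R}_{\ge0}$ with $v(\emptyset)=0$ that are monotone ($v(S)\le v(T)$ for $S\subseteq T$). Demand: for $\mathbf{p}\in\mathbb{R}_{\ge0}^m$ and $M\subseteq[m]$, $\mathcal{D}(v,\mathbf{p},M)$ is the set of all $B\subseteq M$ maximizing $v(B)-\sum_{j\in B}p_j$ over subsets of $M$. Generic: a distribution $D_i$ over valuations is generic if for every $\mathbf{p}\in\mathbb{R}_{\ge0}^m$ and $M\subseteq[m]$, $\mathcal{D}(v_i,\mathbf{p},M)$ contains only one set with probability one over $v_i\sim D_i$. A distribution $D$ over profiles $\mathbf{v}=(v_1,\dots,v_n)$ is generic if each agent's marginal distribution is generic. Sequential sale at prices $\mathbf{p}$: buyers $1,\dots,n$ arrive in this order; buyer $i$ buys a set $X_i\in\mathcal{D}(v_i,\mathbf{p},M_i)$ where $M_i=[m]\setminus(X_1\cup\dots\cup X_{i-1})$ (almost surely unique for generic $D$). $\pi_j(\mathbf{p})$ is the probability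 over $\mathbf{v}\sim D$ that item $j$ is sold. $\alpha$-median prices for generic $D$ ($\alpha\in[0,1/2]$): $\mathbf{p}$ with $\pi_j(\mathbf{p})\le1-\alpha$ for every $j\in[m]$, and $\pi_j(\mathbf{p})\ge\alpha$ for every $j$ with $p_j>0$. *)

(* Defs.v *)
From HB Require Import structures.
From mathcomp Require Import all_boot all_order all_algebra.
From mathcomp Require Import all_classical all_reals all_analysis.
From mathcomp Require Import measurable_realfun measurable_fun_approximation.

Set Implicit Arguments.
Unset Strict Implicit.
Unset Printing Implicit Defensive.

Import Order.TTheory GRing.Theory Num.Theory.
Import numFieldNormedType.Exports.

Local Open Scope classical_set_scope.
Local Open Scope ring_scope.

(* Notations shared by finset.v and classical_sets.v denote finite sets when
   marked %SET and classical sets otherwise. *)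

Record valuation (R : realType) (m : nat) := Valuation {
  valuation_fun :> {set 'I_m} -> R ;
  valuation_set0 : valuation_fun finset.set0 = 0 ;
  valuation_ge0 : forall S : {set 'I_m}, 0 <= valuation_fun S ;
  valuation_mono : forall S T : {set 'I_m},
    S \subset T -> valuation_fun S <= valuation_fun T }.

Section valuation_measurable.
Variables (R : realType) (m : nat).

Definition zero_valuation : valuation R m :=
  @Valuation R m (fun=> 0) erefl (fun=> lexx 0) (fun _ _ _ => lexx 0).

HB.instance Definition _ := gen_eqMixin (valuation R m).
HB.instance Definition _ := gen_choiceMixin (valuation R m).
HB.instance Definition _ := isPointed.Build (valuation R m) zero_valuation.

(* The sigma-algebra inherited from the Borel sets of R^(2^m), generated by
   the evaluation maps v |-> v S. *)
Definition valuation_evals : set (set (valuation R m)) :=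
  \bigcup_(S in [set: {set 'I_m}])
    preimage_set_system setT (fun v : valuation R m => v S) measurable.

HB.instance Definition _ := @isMeasurable.Build (sigma_display valuation_evals)
  (valuation R m) <<s valuation_evals >>
  (@sigma_algebra0 _ setT valuation_evals)
  (@sigma_algebraC _ valuation_evals)
  (@sigma_algebra_bigcup _ setT valuation_evals).

End valuation_measurable.

(* Profiles carry the product sigma-algebra of tuples. *)
Notation profile R n m := (n.-tuple (valuation R m)).

Definition price_vector (R : realType) (m : nat) (p : 'I_m -> R) : Prop :=
  forall j, 0 <= p j.

Definition utility (R : realType) (m : nat) (v : valuation R m)
    (p : 'I_m -> R) (B : {set 'I_m}) : R :=
  v B - \sum_(j in B) p j.

Definition demand (R : realType) (m : nat) (v : valuation R m)
    (p : 'I_m -> R) (M : {set 'I_m}) : {set {set 'I_m}} :=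
  [set B : {set 'I_m} | (B \subset M) &&
    [forall B' : {set 'I_m},
      (B' \subset M) ==> (utility v p B' <= utility v p B)]]%SET.

Definition generic (R : realType) (m : nat)
    (P : probability (valuation R m) R) : Prop :=
  forall p : 'I_m -> R, price_vector p -> forall M : {set 'I_m},
    {ae P, forall v, #|demand v p M| = 1%N}.

Section marginal.
Variables (R : realType) (n m : nat).

Definition agent (i : 'I_n) (v : profile R n m) : valuation R m := tnth v i.

HB.instance Definition _ (i : 'I_n) :=
  isMeasurableFun.Build _ _ _ _ (agent i) (@measurable_tnth _ _ n i).

Definition marginal (D : probability (profile R n m) R) (i : 'I_n)
    : probability (valuation R m) R :=
  distribution D (agent i).

End marginal.

Definition generic_profile (R : realType) (n m : nat)
    (D : probability (profile R n m) R) : Prop :=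
  forall i : 'I_n, generic (marginal D i).

Definition available (n m : nat) (X : 'I_n -> {set 'I_m}) (i : 'I_n)
    : {set 'I_m} :=
  (~: \bigcup_(i' < n | (i' < i)%N) X i')%SET.

(* X is a possible outcome of the sequential sale; for each p it is the only
   one for almost every profile drawn from a generic distribution. *)
Definition sale_outcome (R : realType) (n m : nat) (v : profile R n m)
    (p : 'I_m -> R) (X : 'I_n -> {set 'I_m}) : Prop :=
  forall i : 'I_n, X i \in demand (tnth v i) p (available X i).

Definition sold (R : realType) (n m : nat) (p : 'I_m -> R) (j : 'I_m)
    : set (profile R n m) :=
  [set v | exists2 X, sale_outcome v p X & exists i, j \in X i].

Lemma measurable_eval (R : realType) (m : nat) (S : {set 'I_m}) :
  measurable_fun [set: valuation R m] (fun v : valuation R m => v S).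
Proof.
move=> _ A mA; apply: sub_sigma_algebra.
by exists S => //; exists A.
Qed.

Lemma measurable_utility (R : realType) (m : nat) (p : 'I_m -> R) B :
  measurable_fun [set: valuation R m] (fun v => utility v p B).
Proof.
by apply: measurable_funB; [exact: measurable_eval|exact: measurable_cst].
Qed.

Lemma measurable_demand (R : realType) (m : nat) (p : 'I_m -> R)
    (M B : {set 'I_m}) :
  measurable [set v : valuation R m | B \in demand v p M].
Proof.
rewrite (_ : [set _ | _] = (if B \subset M then setT else set0) `&`
  \bigcap_(B' in [set B' : {set 'I_m} | B' \subset M])
    [set v : valuation R m | utility v p B' <= utility v p B]).
  apply: measurableI; first by case: ifP.
  apply: fin_bigcap_measurable; [exact: finite_finset|] => B' _.
  rewrite -[X in measurable X]setTI.
  by apply: (@measurable_fun_le _ _ R setT (fun v => utility v p B') (fun v => utility v p B)) => //; exact: measurable_utility.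
apply/seteqP; split => v /=.
  by rewrite inE => /andP[-> /forallP H]; split => // B' /= B'M; exact: (implyP (H B')).
case=> BM H; rewrite inE; case: ifP BM => //= _ _.
by apply/forallP => B'; apply/implyP => B'M; exact: (H B').
Qed.

Lemma measurable_sold (R : realType) (n m : nat) (p : 'I_m -> R) (j : 'I_m) :
  measurable (@sold R n m p j).
Proof.
rewrite (_ : @sold R n m p j = \bigcup_(X in [set X : {ffun 'I_n -> {set 'I_m}} | exists i, j \in X i])
  \bigcap_(i in [set: 'I_n]) ((fun v : profile R n m => tnth v i) @^-1` [set v | X i \in demand v p (available X i)])).
  apply: fin_bigcup_measurable; [exact: finite_finset|] => X _; apply: fin_bigcap_measurable; [exact: finite_finset|] => i _.
  rewrite -[X in measurable X]setTI.
  by apply: measurable_tnth => //; exact: measurable_demand.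
apply/seteqP; split => v /=.
  case=> X sX [i jX]; exists (finfun X).
    by exists i; rewrite ffunE.
  move=> i' _ /=; rewrite ffunE.
  rewrite (_ : available (finfun X) i' = available X i'); first exact: sX.
  by congr (~: _)%SET; apply: eq_bigr => ? _; rewrite ffunE.
by case=> X /= [i jX] H; exists X; [move=> i'; exact: H | exists i].
Qed.

Definition sale_prob (R : realType) (n m : nat)
    (D : probability (profile R n m) R) (p : 'I_m -> R) (j : 'I_m) : \bar R :=
  D (sold p j).

Definition median_prices (R : realType) (n m : nat)
    (D : probability (profile R n m) R) (alpha : R) (p : 'I_m -> R) : Prop :=
  [/\ price_vector p,
      forall j, (sale_prob D p j <= (1 - alpha)%:E)%E &
      forall j, 0 < p j -> (alpha%:E <= sale_prob D p j)%E].

(* The index set being finite and the whole space measurable, the product rule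
   over the full family implies it over every subfamily. *)
Definition mutually_independent (d d' : measure_display)
    (Omega : measurableType d) (T : measurableType d') (R : realType)
    (P : probability Omega R) (k : nat) (X : 'I_k -> {RV P >-> T}) : Prop :=
  forall A : 'I_k -> set T, (forall l, measurable (A l)) ->
    P (\bigcap_(l in [set: 'I_k]) (X l @^-1` A l)) =
    (\prod_(l < k) P (X l @^-1` A l))%E.

Definition independent_samples (d d' : measure_display)
    (Omega : measurableType d) (T : measurableType d') (R : realType)
    (D : probability T R) (P : probability Omega R) (k : nat)
    (X : 'I_k -> {RV P >-> T}) : Prop :=
  (forall l (A : set T), measurable A -> P (X l @^-1` A) = D A) /\
  mutually_independent X.

(* Inner probability: E itself need not be measurable. For measurable E this
   is r%:E <= P E. *)
Definition holds_with_prob (d : measure_display) (Omega : measurableType d)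
    (R : realType) (P : probability Omega R) (r : R) (E : set Omega) : Prop :=
  exists F : set Omega, [/\ measurable F, F `<=` E & (r%:E <= P F)%E].

(* Main.v *)
Require Import Defs.
From mathcomp Require Import all_boot all_order all_algebra all_fingroup.
From mathcomp Require Import all_classical all_reals all_analysis.
From mathcomp Require Import measurable_realfun.
From mathcomp Require Import zify ring lra.

(** For a generic D the sale probabilities are continuous in the prices, no item
    sells above a high enough price, and labelling the points of a fine price grid
    by "item j sells with probability less than 1/2" the cubical Sperner lemma of
    Kuhn and compactness give a grid price at which every item with positive price
    sells with probability close to 1/2, the others with probability at most
    about 1/2.

    The outcomes of the sale on s profiles depend on the prices p only through the
    signs of at most s n 4^m affine functionals of p, so that they take at most
    m (s n 4^m + 1)^m values. Symmetrization and chaining over Hamming nets, whose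
    cardinalities are bounded by random sampling, turn this into a uniform deviation
    bound over a countable set of prices without any log (1/eps) factor. The procedure
    returns any price of this set at which the empirical sale frequencies are
    about 1/2. *)

(** Prices range over a continuum and the procedure selects a candidate by choice, so that neither a
    supremum over all prices nor the output is measurable for free. The grid prices of all mesh
    sizes form a countable set. On its first N members a profile only matters through a finite
    pattern of sales, so that a sample has a product law on a finite set and symmetrization becomes
    an exchange of finite sums. The resulting bound does not involve N and passes to the whole set
    by continuity of the measure; success then holds on the complement of a measurable event.

    For the same reason the existence argument returns to a grid point near the limit given by
    compactness, at the price of some slack in the median condition. *)

Set Implicit Arguments.
Unset Strict Implicit.
Unset Printing Implicit Defensive.

Import Order.TTheory GRing.Theory Num.Theory.
Import numFieldNormedType.Exports.

Local Open Scope ring_scope.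

(** * Kuhn's cubical Sperner lemma *)

Section Kuhn.
Variables n K : nat.
Implicit Types (q : {ffun 'I_n.+1 -> 'I_K.+1}) (r : 'S_n.+1)
  (F : {ffun 'I_n.+1 -> nat} -> 'I_n.+1 -> bool).

Definition kuhn_vertex q r (k : nat) : {ffun 'I_n.+1 -> nat} :=
  [ffun i => (q i + (r i < k))%N].

(** Row k is 1 followed by the labels of the k-th vertex of a simplex of Kuhn's triangulation: the
    determinant is (n+1)! times the signed volume of the simplex spanned by the labels. *)
Definition kuhn_mx F q r : 'M[int]_n.+2 :=
  \matrix_(k, b)
    if unlift ord0 b is Some j then (F (kuhn_vertex q r k) j)%:R else 1.

Definition kuhn_facet F q r (k : nat) : int :=
  \det (\matrix_(a < n.+1, j < n.+1) ((F (kuhn_vertex q r (bump k a)) j)%:R : int)).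

(** Up to a factor, the signed volume of the image of the piecewise linear extension of [F]. Being a
    sum of determinants, it can be cancelled facet by facet. *)
Definition kuhn_degree F : int :=
  \sum_(q : {ffun 'I_n.+1 -> 'I_K.+1}) \sum_(r : 'S_n.+1) (-1) ^+ r * \det (kuhn_mx F q r).

Lemma det_kuhn_mx F q r :
  \det (kuhn_mx F q r) = \sum_(k < n.+2) (-1) ^+ k * kuhn_facet F q r k.
Proof.
rewrite (expand_det_col _ ord0); apply: eq_bigr => k _.
rewrite mxE unlift_none mul1r /cofactor addn0; congr (_ * \det _).
by apply/matrixP => a j; rewrite !mxE liftK.
Qed.

(* Exchanging the two directions around an interior vertex flips the sign and
   keeps the opposite facet. *)
Lemma kuhn_facet_interior F q (k : nat) : (0 < k < n.+1)%N ->
  \sum_(r : 'S_n.+1) (-1) ^+ r * kuhn_facet F q r k = 0.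
Proof.
move=> /andP[k0 kn]; set S := LHS.
suff : S = - S by lia.
pose t : 'S_n.+1 := tperm (inord k.-1) (inord k).
have kE : (inord k : 'I_n.+1) = k :> nat by rewrite inordK.
have kE' : (inord k.-1 : 'I_n.+1) = k.-1 :> nat by rewrite inordK //; lia.
have tne : (inord k.-1 : 'I_n.+1) != inord k.
  by apply/eqP => /(congr1 (@nat_of_ord _)); rewrite kE kE'; lia.
rewrite {1}/S (reindex_inj (mulIg t)) -sumrN; apply: eq_bigr => r _ /=.
rewrite odd_permM signr_addb odd_tperm tne expr1 mulrN1 mulNr; congr (- (_ * \det _)).
apply/matrixP => a j; rewrite !mxE; congr ((F _ _)%:R).
apply/ffunP => i; rewrite !ffunE permM; congr (_ + nat_of_bool _)%N.
rewrite /t; case: tpermP => [->|->|//]; rewrite kE kE' /bump; lia.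
Qed.

(** Crossing facet 0 leads to the next cube along the first direction of [r]. There this direction
    comes last, and the common facet is facet [n.+1]. *)
Definition kuhn_rot : 'S_n.+1 := lift_perm ord0 ord_max 1.

Lemma kuhn_rotE (i : 'I_n.+1) :
  kuhn_rot i = (if i == 0%N :> nat then n else i.-1) :> nat.
Proof.
rewrite /kuhn_rot; case: (unliftP ord0 i) => [j|] ->.
  by rewrite lift_perm_lift perm1 /= /bump leqNgt ltn_ord.
by rewrite lift_perm_id.
Qed.

(** The successor [ordS] is cyclic: wrapping around at the far side makes the passage to the next
    simplex a bijection, by which the facets can be reindexed. *)
Definition kuhn_next q r : {ffun 'I_n.+1 -> 'I_K.+1} :=
  [ffun i => if r i == 0%N :> nat then ordS (q i) else q i].

Lemma kuhn_degree_facets F :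
  kuhn_degree F = \sum_(q : {ffun 'I_n.+1 -> 'I_K.+1}) \sum_(r : 'S_n.+1) (-1) ^+ r *
    (kuhn_facet F q r 0 - kuhn_facet F (kuhn_next q r) (r * kuhn_rot)%g n.+1).
Proof.
have -> : kuhn_degree F = \sum_(q : {ffun 'I_n.+1 -> 'I_K.+1}) \sum_(r : 'S_n.+1) (-1) ^+ r * kuhn_facet F q r 0 +
    \sum_(q : {ffun 'I_n.+1 -> 'I_K.+1}) \sum_(r : 'S_n.+1) (-1) ^+ r * ((-1) ^+ n.+1 * kuhn_facet F q r n.+1).
  rewrite -big_split /=; apply: eq_bigr => q _.
  under eq_bigr do rewrite det_kuhn_mx big_distrr.
  rewrite exchange_big /= big_ord_recl big_ord_recr /= [X in _ + (X + _)]big1 ?add0r.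
    by congr (_ + _); apply: eq_bigr => r _; rewrite ?mul1r.
  move=> k _; under eq_bigr do rewrite mulrCA.
  by rewrite -big_distrr /= kuhn_facet_interior ?mulr0 // /bump /= ltnS ltn_ord.
rewrite [in RHS]pair_big /= (eq_bigr (fun p : {ffun 'I_n.+1 -> 'I_K.+1} * 'S_n.+1 => (-1) ^+ p.2 * kuhn_facet F p.1 p.2 0 -
  (-1) ^+ p.2 * kuhn_facet F (kuhn_next p.1 p.2) (p.2 * kuhn_rot)%g n.+1)); last first.
  by move=> p _; rewrite mulrBr.
rewrite big_split /= !pair_big /=; congr (_ + _).
pose g (p : {ffun 'I_n.+1 -> 'I_K.+1} * 'S_n.+1) : {ffun 'I_n.+1 -> 'I_K.+1} * 'S_n.+1 := (kuhn_next p.1 p.2, (p.2 * kuhn_rot)%g).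
have g_inj : injective g.
  move=> [q r] [q' r'] [/ffunP eq_q /mulIg eq_r]; subst r'.
  congr (_, _); apply/ffunP => i; have := eq_q i; rewrite !ffunE.
  by case: eqP => // _ /ordS_inj.
rewrite (reindex_inj g_inj); apply: eq_bigr => -[q r] _ /=.
(* The rotation has sign (-1)^n; with the sign (-1)^(n+1) of the Laplace expansion this gives the
   minus. *)
rewrite odd_permM odd_lift_perm odd_perm1 addbF signr_addb /= signr_odd -mulNr.
have sqr : (-1) ^+ n * (-1) ^+ n = 1 :> int by rewrite -exprMn mulrNN mulr1 expr1n.
by rewrite mulrA; congr (_ * _); rewrite -mulrA exprS mulN1r !mulrN sqr mulr1.
Qed.

(** If there is a cube ahead, the two paired facets coincide and cancel. Otherwise they lie on the
    opposite sides K+1 and 0 of the grid, where [F] and [G] agree. *)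
Lemma eq_kuhn_degree F G :
  (forall x : {ffun 'I_n.+1 -> nat}, (exists i, x i = 0%N \/ x i = K.+1) -> F x =1 G x) ->
  kuhn_degree F = kuhn_degree G.
Proof.
move=> FG; rewrite !kuhn_degree_facets.
apply: eq_bigr => q _; apply: eq_bigr => r _; congr (_ * _).
pose c := (r^-1)%g ord0.
have rc : r c = ord0 by rewrite permKV.
have r0 i : (r i == 0%N :> nat) = (i == c).
  by rewrite -(inj_eq (@perm_inj _ r)) rc.
have [qc|qc] := ltnP (q c) K.
  have same H : kuhn_facet H q r 0 = kuhn_facet H (kuhn_next q r) (r * kuhn_rot)%g n.+1.
    congr (\det _); apply/matrixP => a j; rewrite !mxE; congr ((H _ _)%:R).
    apply/ffunP => i; rewrite !ffunE permM kuhn_rotE r0.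
    have an := ltn_ord a; have rin := ltn_ord (r i).
    have -> : bump n.+1 a = a by rewrite /bump ltnNge -ltnS an.
    rewrite /bump leq0n add1n; case: eqP => [->|].
      by rewrite rc /= modn_small ?ltnS // [(n < a)%N]ltnNge -ltnS an addn0 addn1.
    by move=> /eqP; rewrite -r0 => /eqP; lia.
  by rewrite !same !subrr.
have qcK : q c = K :> nat by have := ltn_ord (q c); lia.
congr (_ - _); congr (\det _); apply/matrixP => a j; rewrite !mxE FG //; exists c.
  by right; rewrite ffunE rc qcK /bump /=; lia.
left; rewrite !ffunE permM kuhn_rotE r0 eqxx /= qcK modnn /bump.
by have := ltn_ord a; rewrite ltnS => an; rewrite [(n < a)%N]ltnNge an add0n ltnNge an.
Qed.

(** A constant label gives a zero column or a second column of ones. Hence on a simplex with nonzero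
    determinant every coordinate takes both labels. *)
Lemma det_kuhn_mx_const F q r (j : 'I_n.+1) (b : bool) :
  (forall k : 'I_n.+2, F (kuhn_vertex q r k) j = b) -> \det (kuhn_mx F q r) = 0.
Proof.
move=> Fb; case: b Fb => Fb.
  rewrite -det_tr; apply: (@determinant_alternate _ _ _ ord0 (lift ord0 j)) => // k.
  by rewrite !mxE unlift_none liftK Fb.
rewrite (expand_det_col _ (lift ord0 j)) big1 // => k _.
by rewrite mxE liftK Fb mul0r.
Qed.

Definition kuhn_step (x : {ffun 'I_n.+1 -> nat}) (j : 'I_n.+1) : bool := (1 < x j)%N.

(** The labels change only between 1 and 2, so that only the cube at (1,...,1) contributes; each of
    its simplices contributes [(-1) ^+ r] squared. *)
Lemma kuhn_degree_step : (0 < K)%N -> kuhn_degree kuhn_step != 0.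
Proof.
move=> K0; pose q1 : {ffun 'I_n.+1 -> 'I_K.+1} := [ffun=> inord 1].
have q1E i : q1 i = 1%N :> nat by rewrite ffunE inordK.
have vq1 r (k : 'I_n.+2) j : kuhn_step (kuhn_vertex q1 r k) j = (r j < k)%N.
  by rewrite /kuhn_step ffunE q1E; case: (r j < k)%N.
have det1 r : \det (kuhn_mx kuhn_step q1 r) = (-1) ^+ r.
  have -> : kuhn_mx kuhn_step q1 r = col_perm (lift0_perm r) (kuhn_mx kuhn_step q1 1%g).
    apply/matrixP => k b; rewrite !mxE; case: (unliftP ord0 b) => [j|] ->.
      by rewrite lift0_perm_lift liftK !vq1 perm1.
    by rewrite lift0_perm0 unlift_none.
  rewrite col_permE det_mulmx det_perm odd_permV odd_lift_perm addFb det_trig.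
    rewrite big1 ?mul1r // => b _; rewrite mxE; case: (unliftP ord0 b) => [j ->|//].
    by rewrite vq1 perm1 /= leqnn.
  apply/is_trig_mxP => a b ab; rewrite mxE; case: (unliftP ord0 b) ab => [j|] -> //.
  by rewrite vq1 perm1 /= /bump /= add1n ltnS => aj; rewrite ltnNge aj.
rewrite /kuhn_degree (bigD1 q1) //= [X in _ + X]big1 ?addr0; last first.
  move=> q /eqP neq; apply: big1 => r _.
  have [j qj] : exists j, q j != 1%N :> nat.
    apply/existsP; apply: contra_notT neq => /existsPn qE; apply/ffunP => i.
    by apply/val_inj; rewrite /= q1E; apply/eqP; rewrite -[_ == _]negbK qE.
  rewrite (@det_kuhn_mx_const _ _ _ j (1 < q j)%N) ?mulr0 // => k.
  by rewrite /kuhn_step ffunE; case: (r j < k)%N; lia.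
under eq_bigr do rewrite det1 -expr2 sqrr_sign.
by rewrite sumr_const -mulr_natl mulr1 pnatr_eq0 -lt0n; apply/card_gt0P; exists 1%g.
Qed.

End Kuhn.

Lemma kuhn_lemma (n N : nat) (l : {ffun 'I_n.+1 -> nat} -> 'I_n.+1 -> bool) :
  (0 < N)%N ->
  (forall (x : {ffun 'I_n.+1 -> nat}) i, x i = 0%N -> l x i = false) ->
  (forall (x : {ffun 'I_n.+1 -> nat}) i, x i = N -> l x i) ->
  exists q : {ffun 'I_n.+1 -> nat}, (forall i, q i < N)%N /\
    forall i (b : bool), exists2 x : {ffun 'I_n.+1 -> nat},
      (forall j, (q j <= x j <= q j + 1)%N /\ (x j <= N)%N) & l x i = b.
Proof.
move=> N0 l0 lN.
(* A collar around the grid, labelled canonically, fixes the degree. *)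
pose inner (x : {ffun 'I_n.+1 -> nat}) := [forall i, (0 < x i < N.+2)%N].
pose pred_pt (x : {ffun 'I_n.+1 -> nat}) := [ffun i => (x i).-1].
pose F x i := if inner x then l (pred_pt x) i else kuhn_step x i.
have Flo (x : {ffun 'I_n.+1 -> nat}) i : (x i <= 1)%N -> F x i = false.
  move=> xi; rewrite /F /kuhn_step; case: ifP => _; last by rewrite ltnNge xi.
  by apply: l0; rewrite ffunE; lia.
have Fhi (x : {ffun 'I_n.+1 -> nat}) i : (N < x i)%N -> F x i.
  move=> xi; rewrite /F /kuhn_step; case: ifP => [/forallP/(_ i) xi'|_]; last by lia.
  by apply: lN; rewrite ffunE; lia.
(* The grid 0..N sits at 1..N+1 inside 0..N+2, whose boundary points are not [inner]. *)
have dF : kuhn_degree N.+1 F != 0.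
  rewrite (@eq_kuhn_degree _ _ _ (@kuhn_step n)) ?kuhn_degree_step // => x [i xi] j.
  by rewrite /F ifF //; apply/negP => /forallP/(_ i); case: xi => ->; rewrite ?ltnn ?andbF.
have [[q r] /= dqr] : exists p : {ffun 'I_n.+1 -> 'I_N.+2} * 'S_n.+1, \det (kuhn_mx F p.1 p.2) != 0.
  apply/existsP; apply: contraT => /existsPn nq; move/eqP: dF; case.
  rewrite /kuhn_degree pair_big big1 //= => p _.
  by have := nq p; rewrite negbK => /eqP->; rewrite mulr0.
have both i (b : bool) : exists k : 'I_n.+2, F (kuhn_vertex q r k) i = b.
  suff /existsP[k /eqP Fk] : [exists k : 'I_n.+2, F (kuhn_vertex q r k) i == b] by exists k.
  apply: contraT => /existsPn nk; move/eqP: dqr; case.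
  apply: (@det_kuhn_mx_const _ _ _ _ _ i (~~ b)) => k.
  by have := nk k; case: b {nk} (F _ _) => -[].
(* For any other value of [q i] the coordinate i of the whole cell stays in a zone of constant
   label, against [both]. *)
have qbd i : (1 <= q i <= N)%N.
  have [k Fk] := both i false; have [k' Fk'] := both i true; apply/andP; split.
    rewrite lt0n; apply/eqP => qi; move: Fk'; rewrite Flo // ffunE qi.
    by case: (_ < _)%N.
  rewrite leqNgt; apply/negP => qi; move: Fk; rewrite Fhi // ffunE; lia.
exists (pred_pt [ffun i => q i : nat]); split=> [i|i b]; first by rewrite !ffunE; have := qbd i; lia.
have [k Fk] := both i b; exists (pred_pt (kuhn_vertex q r k)).
  move=> j; rewrite !ffunE; have := qbd j; case: (r j < k)%N; lia.
rewrite -Fk /F ifT //; apply/forallP => j; rewrite ffunE; have := qbd j; case: (r j < k)%N; lia.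
Qed.

(** * Sign patterns of affine functionals *)

Definition affine (R : realFieldType) d (f : ('I_d -> R) * R) (p : 'I_d -> R) : R :=
  \sum_i f.1 i * p i + f.2.

Definition halfspaces (R : realFieldType) d (L : seq (('I_d -> R) * R))
    (p : 'I_d -> R) : seq bool :=
  [seq affine f p <= 0 | f <- L].

(** The restriction of [g] to the hyperplane where [f] vanishes, in the coordinates other than
    [i0]. *)
Definition elim_coord (R : realFieldType) d (i0 : 'I_d.+1)
    (f g : ('I_d.+1 -> R) * R) : ('I_d -> R) * R :=
  (fun i => g.1 (lift i0 i) - g.1 i0 * f.1 (lift i0 i) / f.1 i0,
   g.2 - g.1 i0 * f.2 / f.1 i0).

Lemma affine_elim_coord (R : realFieldType) d (i0 : 'I_d.+1)
    (f g : ('I_d.+1 -> R) * R) p : f.1 i0 != 0 -> affine f p = 0 ->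
  affine (elim_coord i0 f g) (p \o lift i0) = affine g p.
Proof.
rewrite /affine /= => fi0; rewrite (bigD1_ord i0) //= => f0.
rewrite [in RHS](bigD1_ord i0) //=.
have -> : p i0 = - (\sum_(i < d) f.1 (lift i0 i) * p (lift i0 i) + f.2) / f.1 i0.
  by apply: (mulIf fi0); rewrite divfK //; lra.
under eq_bigr do rewrite mulrBl.
rewrite big_split /= sumrN.
have -> : \sum_(i < d) g.1 i0 * f.1 (lift i0 i) / f.1 i0 * p (lift i0 i) =
    g.1 i0 / f.1 i0 * \sum_(i < d) f.1 (lift i0 i) * p (lift i0 i).
  by rewrite big_distrr; apply: eq_bigr => i _; rewrite /=; ring.
by field.
Qed.

Lemma affine_convex (R : realFieldType) d (f : ('I_d -> R) * R) (t : R) p q :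
  affine f (fun i => t * p i + (1 - t) * q i) =
  t * affine f p + (1 - t) * affine f q.
Proof.
rewrite /affine; under eq_bigr do rewrite mulrDr !(mulrCA (f.1 _)).
by rewrite big_split /= -!big_distrr /=; ring.
Qed.

Lemma card_tuple_cons (N : nat) (S : {set N.+1.-tuple bool}) :
  (#|S| = #|[set t : N.-tuple bool | [tuple of true :: t] \in S]| +
    #|[set t : N.-tuple bool | [tuple of false :: t] \in S]|)%N.
Proof.
have cons_inj (b : bool) : injective (fun t : N.-tuple bool => [tuple of b :: t]).
  by move=> t t' /(congr1 val) [] /val_inj.
rewrite -(card_imset _ (@cons_inj true)) -(card_imset _ (@cons_inj false)) -cardsUI.
rewrite (_ : _ :&: _ = finset.set0) ?cards0 ?addn0; last first.
  apply/setP => t; rewrite !inE; apply/negP => /andP[/imsetP[u _ ->] /imsetP[u' _]].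
  by move/(congr1 val).
apply: eq_card => t; rewrite inE; apply/idP/orP => [tS|[]].
- case: (tupleP t) tS => -[] u uS; [left|right];
    by apply/imsetP; exists u; rewrite ?inE.
- by case/imsetP => u; rewrite inE => uS ->.
- by case/imsetP => u; rewrite inE => uS ->.
Qed.

(** Deleting the first functional [f] merges only the patterns realized on both sides of its
    hyperplane. These are realized on the hyperplane, in one dimension less, and (N+1)^(d+1) +
    (N+1)^d <= (N+2)^(d+1). If [f] is constant, no pattern has both sides. *)
Lemma card_halfspaces (R : realFieldType) d N (L : seq (('I_d -> R) * R))
    (S : {set N.-tuple bool}) : size L = N ->
  (forall t, t \in S -> exists p, tval t = halfspaces L p) ->
  (#|S| <= N.+1 ^ d)%N.
Proof.
elim: N d L S => [|N IH] d [|f L] S //= sL LS.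
  rewrite exp1n; apply: leq_trans (max_card _) _.
  by rewrite card_tuple expn0.
case: sL => sL; rewrite card_tuple_cons -cardsUI.
set St := [set _ | _]; set Sf := [set _ | _].
have SU : (#|St :|: Sf| <= N.+1 ^ d)%N.
  apply: (IH _ L) => // t; rewrite !inE.
  by case/orP => /LS [p /= [_ ->]]; exists p.
case: d f L S LS sL @St @Sf SU => [|d] f L S LS sL St Sf SU.
  rewrite (_ : St :&: Sf = finset.set0) ?cards0 ?addn0 ?expn0 //.
  apply/setP => t; rewrite !inE; apply/negP => /andP[/LS [p /= []]].
  by rewrite /affine big_ord0 => f0 _ /LS [q /= []]; rewrite /affine big_ord0 -f0.
suff SI : (#|St :&: Sf| <= N.+1 ^ d)%N.
  apply: leq_trans (leq_add SU SI) _.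
  rewrite [X in (_ <= X)%N]expnS expnS -mulSnr leq_mul2l.
  by case: (d) => [|d']; rewrite ?expn0 // leq_exp2r ?leqnSn.
have [/existsP [i0 fi0]|/existsPn f0] := boolP [exists i, f.1 i != 0]; last first.
  have cst p : affine f p = f.2.
    by rewrite /affine big1 ?add0r // => i _; have := f0 i; rewrite negbK => /eqP->; rewrite mul0r.
  rewrite (_ : St :&: Sf = finset.set0) ?cards0 //.
  apply/setP => t; rewrite !inE; apply/negP => /andP[/LS [p /= []]].
  by rewrite cst => fp _ /LS [q /= []]; rewrite cst -fp.
apply: (IH _ [seq elim_coord i0 f g | g <- L]); first by rewrite size_map.
move=> t; rewrite !inE => /andP[/LS [p /= [fp tp]] /LS [q /= [fq tq]]].
have {}fp : affine f p <= 0 by rewrite -fp.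
have {}fq : 0 < affine f q by rewrite ltNge -fq.
(* The open halfspaces being convex too, the point of the segment [p, q] on
   the hyperplane has the same pattern with respect to the remaining ones. *)
pose s := affine f q / (affine f q - affine f p).
have den : 0 < affine f q - affine f p by lra.
have s0 : 0 <= s by rewrite divr_ge0 // ltW.
have s1 : 0 <= 1 - s.
  by rewrite subr_ge0 ler_pdivrMr // mul1r; lra.
pose z i := s * p i + (1 - s) * q i.
have fz : affine f z = 0.
  by rewrite affine_convex /s; field; rewrite gt_eqF.
exists (z \o lift i0); rewrite tp /halfspaces -map_comp.
apply/eq_in_map => g gL /=; rewrite affine_elim_coord // affine_convex.
have := tq; rewrite tp /halfspaces => /eq_in_map /(_ g gL) /=.
case: (leP (affine g p) 0) => gp /esym.
  by move=> gq; apply/esym; rewrite addrC -(addr0 0) lerD // mulr_ge0_le0.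
move/negbT; rewrite -ltNge => gq; apply/esym/negbTE; rewrite -ltNge.
have [->|s_neq0] := eqVneq s 0; first by rewrite mul0r add0r subr0 mul1r.
have sp : 0 < s by rewrite lt_neqAle eq_sym s_neq0.
by apply: ltr_pwDl; [exact: mulr_gt0 | exact: mulr_ge0 s1 (ltW gq)].
Qed.

(** * Rademacher sums and chaining *)

(** Weaker than the sharp exponent x^2/2, but a consequence of 1 + y <= e^y alone: through e^y <=
    1/(1-y) for small x, and x <= 2x^2 otherwise. *)
Lemma expR_cosh_le (R : realType) (x : R) :
  expR x + expR (- x) <= 2 * expR (2 * x ^+ 2).
Proof.
have [x2|x2] := ltP (x ^+ 2) (1 / 2).
  have x1 : -1 < x < 1.
    by apply/andP; split; nra.
  have le y : y < 1 -> expR y <= (1 - y)^-1 :> R.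
    move=> y1; rewrite -[expR y]invrK -expRN lef_pV2 ?posrE ?expR_gt0 ?subr_gt0 //.
    exact: expR_ge1Dx.
  have [lx lNx] : expR x <= (1 - x)^-1 /\ expR (- x) <= (1 + x)^-1.
    by split; [apply: le|rewrite -[x in leRHS]opprK; apply: le]; lra.
  apply: le_trans (lerD lx lNx) _.
  apply: (@le_trans _ _ (2 * (1 + 2 * x ^+ 2))); last first.
    by rewrite ler_pM2l // expR_ge1Dx.
  have -> : (1 - x)^-1 + (1 + x)^-1 = 2 / (1 - x ^+ 2).
    by field; apply/and3P; split => //; rewrite gt_eqF //; nra.
  by rewrite ler_pM2l // -[leLHS]mul1r ler_pdivrMr; nra.
have le y : y ^+ 2 = x ^+ 2 -> expR y <= expR (2 * x ^+ 2).
  by move=> yx; rewrite ler_expR -yx; move: x2; rewrite -yx; nra.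
rewrite mulrDl !mul1r; apply: lerD; apply: le => //; exact: sqrrN.
Qed.

Section Rademacher.
Variables (R : realType) (k : nat).
Implicit Types (sigma : {ffun 'I_k -> bool}) (u : 'I_k -> R).

Definition signed_sum u sigma : R := \sum_l (-1) ^+ sigma l * u l.

Lemma rademacher_mgf u (c : R) :
  \sum_sigma expR (c * signed_sum u sigma) <=
  2 ^+ k * expR (2 * c ^+ 2 * \sum_l u l ^+ 2).
Proof.
have -> : \sum_sigma expR (c * signed_sum u sigma) =
    \prod_(l < k) \sum_(b : bool) expR (c * ((-1) ^+ b * u l)).
  rewrite bigA_distr_bigA /=; apply: eq_bigr => sigma _.
  by rewrite /signed_sum big_distrr expR_sum.
have -> : 2 ^+ k * expR (2 * c ^+ 2 * \sum_l u l ^+ 2) =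
    \prod_(l < k) (2 * expR (2 * (c * u l) ^+ 2)).
  rewrite big_split /= prodr_const card_ord -expR_sum; congr (_ * expR _).
  by rewrite big_distrr; apply: eq_bigr => l _ /=; ring.
apply: ler_prod => l _; rewrite big_bool /= expr1 expr0 mulN1r mul1r mulrN.
by rewrite addr_ge0 ?expR_ge0 //= addrC expR_cosh_le.
Qed.

Lemma signed_sumN u sigma : signed_sum (fun l => - u l) sigma = - signed_sum u sigma.
Proof. by rewrite /signed_sum -sumrN; apply: eq_bigr => l _; rewrite mulrN. Qed.

Lemma rademacher_tail u (t W : R) : 0 <= t -> 0 < W -> \sum_l u l ^+ 2 <= W ->
  #|[pred sigma | t < `|signed_sum u sigma|]|%:R <=
  2 * 2 ^+ k * expR (- (t ^+ 2 / (8 * W))).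
Proof.
move=> t0 W0 uW.
have one v : \sum_l v l ^+ 2 <= W ->
    #|[pred sigma | t < signed_sum v sigma]|%:R <=
    2 ^+ k * expR (- (t ^+ 2 / (8 * W))).
  (* The minimizer of the Chernoff exponent 2c^2 W - ct. *)
  move=> vW; pose c := t / (4 * W).
  have c0 : 0 <= c by rewrite divr_ge0 // mulr_ge0 // ltW.
  have le1 : #|[pred sigma | t < signed_sum v sigma]|%:R * expR (c * t) <=
      \sum_sigma expR (c * signed_sum v sigma).
    rewrite -sum1_card natr_sum big_distrl /= [leRHS](bigID [pred sigma | t < signed_sum v sigma]) /=.
    rewrite -[leLHS]addr0; apply: lerD; last by apply: sumr_ge0 => s _; exact: expR_ge0.
    by apply: ler_sum => s /ltW ts; rewrite mul1r ler_expR ler_wpM2l.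
  rewrite -(ler_pM2r (expR_gt0 (c * t))); apply: le_trans le1 _.
  apply: le_trans (rademacher_mgf _ _) _; rewrite -[leRHS]mulrA ler_pM2l ?exprn_gt0 //.
  rewrite -expRD ler_expR; apply: (@le_trans _ _ (2 * c ^+ 2 * W)).
    by rewrite ler_wpM2l // mulr_ge0 // sqr_ge0.
  by rewrite le_eqVlt; apply/orP; left; apply/eqP; rewrite /c; field; rewrite gt_eqF.
have uNW : \sum_l (- u l) ^+ 2 <= W by under eq_bigr do rewrite sqrrN.
rewrite -mulrA mulr2n mulrDl !mul1r; apply: le_trans (lerD (one u uW) (one _ uNW)).
rewrite -natrD ler_nat -cardUI; apply: leq_trans (leq_addr _ _).
apply/subset_leq_card/fintype.subsetP => s; rewrite !inE signed_sumN.
by rewrite lter_normr.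
Qed.
End Rademacher.

(** * Separated sets and nets for the Hamming distance *)

Lemma double_pow_pred (q : nat) : (0 < q)%N -> (2 * q.-1 ^ q <= q ^ q)%N.
Proof.
case: q => // p _; rewrite /=.
have [->|p0] := posnP p; first by [].
(* Bernoulli's inequality 1 + n/p <= (1 + 1/p)^n, multiplied by p^(n+1). *)
have step n : (p ^ n.+1 + n * p ^ n <= p * p.+1 ^ n)%N.
  elim: n => [|n IH]; first by rewrite expn1 expn0 mul0n addn0 muln1.
  rewrite [in leqRHS]expnS mulnCA; apply: (@leq_trans (p.+1 * (p ^ n.+1 + n * p ^ n))); last by rewrite leq_mul2l IH orbT.
  rewrite !expnS; move: (p ^ n)%N => y; nia.
rewrite -(leq_pmul2l p0); apply: leq_trans (step p.+1); rewrite !expnS.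
move: (p ^ p)%N => y; nia.
Qed.

Definition hamming (k : nat) (a b : {ffun 'I_k -> bool}) : nat :=
  #|[pred l | a l != b l]|.

(* Random sampling (Dudley): s = q * e random coordinates separate a pair at
   distance > k / q except with probability (1 - 1/q)^s <= 2^-e. *)
Lemma card_separated (k q e B : nat) (A : {set {ffun 'I_k -> bool}}) :
  (0 < q)%N -> (0 < B)%N -> (B.+1 * B.+1 < 2 ^ e)%N ->
  (forall u : 'I_(q * e) -> 'I_k, #|[set [ffun l => (a : {ffun 'I_k -> bool}) (u l)] | a in A]%SET| <= B)%N ->
  (forall a b, a \in A -> b \in A -> a != b -> k < q * hamming a b)%N ->
  (#|A| <= B)%N.
Proof.
move=> q0 B0 Be proj sep; rewrite leqNgt; apply/negP => BA.
have /card_geqP [A' [uA' sA' A'A]] := BA.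
pose P := [pred ab | [&& ab.1 \in A', ab.2 \in A' & ab.1 != ab.2]] :
  pred ({ffun 'I_k -> bool} * {ffun 'I_k -> bool}).
pose E (ab : {ffun 'I_k -> bool} * {ffun 'I_k -> bool}) :=
  [pred u : {ffun 'I_(q * e) -> 'I_k} | [forall l, ab.1 (u l) == ab.2 (u l)]].
have cP : (#|P| <= B.+1 * B.+1)%N.
  rewrite -sA' -(card_uniqP uA') -cardX; apply/subset_leq_card/fintype.subsetP.
  by move=> [a b] /and3P[/= aA bA _]; rewrite inE /= aA.
have cE ab : P ab -> (q ^ (q * e) * #|E ab| <= (q.-1 * k) ^ (q * e))%N.
  case: ab => a b /and3P[/= aA bA ab].
  have := sep _ _ (A'A _ aA) (A'A _ bA) ab.
  have -> : #|E (a, b)| = ((k - hamming a b) ^ (q * e))%N.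
    have -> : (k - hamming a b)%N = #|[pred l | a l == b l]|.
      rewrite -[X in (X - _)%N]card_ord -(cardC [pred l | a l != b l]) addKn.
      by apply: eq_card => l; rewrite !inE negbK.
    rewrite -[X in (_ ^ X)%N]card_ord -card_ffun_on; apply: eq_card => u.
    by rewrite [LHS]inE; apply/forallP/ffun_onP => H l; have := H l; rewrite inE.
  move=> dist; rewrite -expnMn; case: (posnP (q * e)) => [->|qe0]; first by rewrite !expn0.
  by rewrite leq_exp2r //; move: dist; move: (hamming a b) => d; case: q q0 {sep proj E qe0} => // q _ /=; nia.
(* Pigeonhole: the B+1 elements of [A'] have at most B traces along [u], so that some pair agrees
   there. *)
have cov (u : {ffun 'I_(q * e) -> 'I_k}) : (1 <= \sum_(ab in P) (u \in E ab))%N.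
  rewrite lt0n; apply/negP; rewrite sum_nat_eq0 => /forallP cov.
  pose f (a : {ffun 'I_k -> bool}) := [ffun l => a (u l)].
  have f_inj : {in [set a in A']%SET &, injective f}.
    move=> a b; rewrite !inE => aA bA /ffunP fab; apply/eqP; apply: contraT => ab.
    have /implyP := cov (a, b); rewrite inE /= aA bA ab => /(_ isT).
    rewrite eqb0 inE => /negP[]; apply/forallP => l /=.
    by have := fab l; rewrite !ffunE => ->.
  have := proj u; rewrite leqNgt => /negP[]; rewrite -sA' -(card_uniqP uA').
  rewrite -[leqLHS]cardsE -(card_in_imset f_inj); apply/subset_leq_card/imsetS.
  by apply/fintype.subsetP => a; rewrite inE => /A'A.
have total : (k ^ (q * e) <= \sum_(ab in P) #|E ab|)%N.
  rewrite -[X in (X ^ _)%N]card_ord -[X in (_ ^ X)%N]card_ord -card_ffun -sum1_card.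
  apply: leq_trans (leq_sum _ (fun u _ => cov u)) _; rewrite exchange_big /=.
  apply: leq_sum => ab _; rewrite -sum1_card [leqRHS]big_mkcond /=.
  by apply: leq_sum => u _; case: (u \in _).
have le : (q ^ (q * e) * k ^ (q * e) <= #|P| * (q.-1 * k) ^ (q * e))%N.
  apply: leq_trans (leq_mul (leqnn _) total) _.
  by rewrite big_distrr /= -sum_nat_const; exact: leq_sum.
move: le; rewrite expnMn mulnA leq_mul2r expn_eq0 => /orP[/andP[/eqP k0 _]|le].
  move: BA; rewrite ltnNge => /negP[]; apply: leq_trans B0; apply: leq_trans (max_card _) _.
  by rewrite card_ffun card_ord k0 expn0.
have {}le := leq_trans le (leq_mul cP (leqnn _)).
have e0 : (0 < e)%N by case: (e) Be => //; rewrite ltnS; case: (B) B0.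
(* Now 2^e (q-1)^(qe) <= q^(qe) <= (B+1)^2 (q-1)^(qe), against (B+1)^2 < 2^e unless q = 1; in that
   case the last term is 0. *)
have := double_pow_pred q0; rewrite -(leq_exp2r _ _ e0).
rewrite expnMn -!expnM => dbl; have := leq_trans dbl le.
rewrite leq_mul2r leqNgt Be orbF => /eqP z; move: le.
by rewrite z muln0 leqn0 expn_eq0 eqn0Ngt q0.
Qed.

(** A growth bound of Sauer-Shelah type. Repetitions in [u] are allowed, as coordinates are sampled
    with replacement. *)
Definition poly_growth (k m h : nat) (A : {set {ffun 'I_k -> bool}}) :=
  forall s (u : 'I_s -> 'I_k), (0 < s)%N ->
    (#|[set [ffun l => (a : {ffun 'I_k -> bool}) (u l)] | a in A]%SET| <= (s * 2 ^ h) ^ m)%N.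

(** A maximal separated subset is a net. Its size is bounded by the number of traces on 4^j e
    coordinates with e = 2^(2j+4h), which is at most 2^((4j+5h)m); this e exceeds twice the
    logarithm of the bound, as the sampling argument requires. *)
Lemma ex_net (k m h j : nat) (A : {set {ffun 'I_k -> bool}}) :
  (0 < m <= h)%N -> (0 < j)%N -> poly_growth m h A ->
  exists N : {set {ffun 'I_k -> bool}},
    [/\ N \subset A, (#|N| <= 2 ^ ((4 * j + 5 * h) * m))%N &
      forall a, a \in A -> exists2 b, b \in N & (4 ^ j * hamming a b <= k)%N].
Proof.
move=> /andP[m0 mh] j0 growth.
pose separated := [pred N : {set {ffun 'I_k -> bool}} | (N \subset A) &&
  [forall a in N, forall b in N, (a != b) ==> (k < 4 ^ j * hamming a b)%N]].
have [N Nmax _] : {N | maxset separated N & finset.set0 \subset N}.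
  apply: maxset_exists; rewrite inE /= finset.sub0set /=.
  by apply/forall_inP => a; rewrite inE.
have /maxsetP[/andP[NA /forall_inP sepN] maxN] := Nmax.
have sep a b : a \in N -> b \in N -> a != b -> (k < 4 ^ j * hamming a b)%N.
  by move=> aN bN; have /forall_inP/(_ b bN)/implyP := sepN a aN.
have hammingC a b : @hamming k a b = hamming b a.
  by apply: eq_card => l; rewrite !inE eq_sym.
exists N; split=> //.
  apply: (@card_separated _ (4 ^ j) (2 ^ (2 * j + 4 * h))) => //.
  - by rewrite expn_gt0.
  - by rewrite expn_gt0.
  - set E := ((4 * j + 5 * h) * m)%N.
    have ltE : ((2 ^ E).+1 <= 2 ^ E.+1)%N.
      by rewrite expnS mul2n -addnn -addn1 leq_add2l expn_gt0.
    apply: leq_ltn_trans (leq_mul ltE ltE) _; rewrite -expnD ltn_exp2l //.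
    have p4 x : (0 < x)%N -> (4 * x <= 4 ^ x)%N.
      by elim: x => // -[//|x] IH _; have := IH isT; rewrite !expnS; lia.
    have -> : (2 ^ (2 * j + 4 * h) = 4 ^ j * (4 ^ h * 4 ^ h))%N.
      by rewrite -[4%N in RHS]/(2 ^ 2)%N -!expnM -!expnD; congr (_ ^ _)%N; lia.
    have h0 : (0 < h)%N by apply: leq_trans mh.
    apply: leq_trans (leq_mul (p4 _ j0) (leq_mul (p4 _ h0) (p4 _ h0))).
    have jm : (j * m <= j * (h * h))%N by rewrite leq_mul2l; nia.
    have hm : (h * m <= j * (h * h))%N by nia.
    have : (1 <= j * (h * h))%N by rewrite !muln_gt0 j0 h0.
    by rewrite /E mulnDl -!mulnA; move: jm hm; lia.
  - move=> u; apply: leq_trans (_ : _ <= #|[set [ffun l => (a : {ffun 'I_k -> bool}) (u l)] | a in A]%SET|)%N _.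
      by apply/subset_leq_card/imsetS.
    apply: leq_trans (growth _ u _) _; first by rewrite muln_gt0 !expn_gt0.
    rewrite -[4%N]/(2 ^ 2)%N -expnM -!expnD -expnM leq_exp2l //.
    by rewrite leq_mul2r; apply/orP; right; lia.
move=> a aA; have [aN|aN] := boolP (a \in N).
  exists a => //; rewrite (_ : hamming a a = 0%N) ?muln0 //.
  by apply: eq_card0 => l; rewrite !inE eqxx.
have [/exists_inP[b bN ab]|/exists_inPn far] :=
  boolP [exists b in N, (4 ^ j * hamming a b <= k)%N]; first by exists b.
suff aNN : separated (a |: N)%SET.
  by move: aN; rewrite -(maxN _ aNN (finset.subsetUr _ _)) !inE eqxx.
rewrite inE /= finset.subUset finset.sub1set aA NA /=.
apply/forall_inP => b; rewrite !inE => bN; apply/forall_inP => c; rewrite !inE => cN.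
apply/implyP; case/predU1P: bN => [->|bN]; case/predU1P: cN => [->|cN].
- by rewrite eqxx.
- by move=> _; rewrite ltnNge far.
- by move=> _; rewrite hammingC ltnNge far.
- exact: sep.
Qed.

(** * Chaining *)

Lemma card_exists_le (T I : finType) (P : pred I) (E : I -> pred T) :
  (#|[pred x | [exists (i | P i), E i x]]| <= \sum_(i | P i) #|E i|)%N.
Proof.
under [leqRHS]eq_bigr do rewrite -sum1_card big_mkcond.
rewrite exchange_big -sum1_card big_mkcond /=; apply: leq_sum => x _.
rewrite inE; case: ifP => // /exists_inP[i Pi Ex].
by rewrite (bigD1 i) //= -topredE /= Ex.
Qed.

Lemma expR_natl (R : realType) (n : nat) : (2 ^ n)%N%:R <= expR n%:R :> R.
Proof.
rewrite natrX -[in leRHS](mulr1 n%:R) expRM_natl.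
by apply: lerXn2r; rewrite ?nnegrE ?expR_ge0 //; have := expR_ge1Dx (1 : R); lra.
Qed.

Lemma sum_half_pow (R : realFieldType) (n : nat) :
  \sum_(i < n) (2 ^+ i.+1)^-1 <= 1 :> R.
Proof.
suff -> : \sum_(i < n) (2 ^+ i.+1)^-1 = 1 - (2 ^+ n)^-1 :> R.
  by rewrite gerBl invr_ge0 exprn_ge0.
elim: n => [|n IH]; first by rewrite big_ord0 expr0 invr1 subrr.
by rewrite big_ord_recr /= IH exprS; field; rewrite expf_neq0.
Qed.

Lemma sum_nat_half_pow (R : realFieldType) (n : nat) :
  \sum_(i < n) i.+1%:R / 2 ^+ i.+1 <= 2 :> R.
Proof.
suff -> : \sum_(i < n) i.+1%:R / 2 ^+ i.+1 = 2 - (n.+2)%:R / 2 ^+ n :> R.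
  by rewrite gerBl divr_ge0 ?exprn_ge0.
elim: n => [|n IH]; first by rewrite big_ord0 expr0 divr1 subrr.
rewrite big_ord_recr /= IH exprS -!natr1; field; rewrite expf_neq0 //.
Qed.

(* Chaining through nets N_i of mesh k / 4^i: an element of N_(i+1) and its
   neighbour in N_i differ in at most k / 4^i coordinates, so that their signed
   sums differ by more than t_i with probability at most exp(-theta^2 k (i+1)^2 / 32),
   which beats the number 2^O((i + h) m) of links; the t_i add up to 2 theta k. *)
Lemma chaining (R : realType) (k m h : nat) (A : {set {ffun 'I_k -> bool}})
    (theta delta : R) :
  (0 < k)%N -> (0 < m <= h)%N -> poly_growth m h A -> 0 < delta < 1 -> 0 <= theta ->
  18 * (h * m)%:R + ln (4 / delta) <= theta ^+ 2 * k%:R / 32 ->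
  #|[pred sigma | [exists a in A,
      2 * theta * k%:R < `|signed_sum (fun l => (a l)%:R) sigma|]]|%:R <=
  delta * 2 ^+ k.
Proof.
move=> k0 mh growth /andP[d0 d1] th0 large.
pose S (a sigma : {ffun 'I_k -> bool}) : R := signed_sum (fun l => (a l)%:R) sigma.
(* At level 0 the zero function alone is a net of mesh k, and its signed sum vanishes: the chains
   start there. *)
have /choice [N NP] : forall j, exists N : {set {ffun 'I_k -> bool}},
  [/\ if j is 0 then N = [set [ffun=> false]]%SET else N \subset A,
    (#|N| <= 2 ^ ((4 * j + 5 * h) * m))%N &
    forall a, a \in A -> exists2 b, b \in N & (4 ^ j * hamming a b <= k)%N].
  case=> [|j].
    exists [set [ffun=> false]]%SET; split=> //; first by rewrite cards1 expn_gt0.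
    move=> a _; exists [ffun=> false]; first by rewrite inE.
    by rewrite mul1n -[leqRHS]card_ord max_card.
  by have [N [NA cN cov]] := ex_net mh (ltn0Sn j) growth; exists N.
pose t i : R := theta * k%:R * (i.+1%:R / 2 ^+ i.+1).
pose bad i := [pred sigma | [exists (p | [&& p.1 \in N i.+1, p.2 \in N i &
  (4 ^ i * hamming p.1 p.2 <= k)%N]), t i < `|S p.1 sigma - S p.2 sigma|]].
have card_bad i : #|bad i|%:R <= delta * 2 ^+ k * (2 ^+ i.+1)^-1.
  pose P := [pred p : {ffun 'I_k -> bool} * {ffun 'I_k -> bool} |
    [&& p.1 \in N i.+1, p.2 \in N i & (4 ^ i * hamming p.1 p.2 <= k)%N]].
  pose e := expR (- (theta ^+ 2 * k%:R / 32 * i.+1%:R ^+ 2)).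
  have kR0 : 0 < k%:R :> R by rewrite ltr0n.
  have tail p : P p ->
      #|[pred sigma | t i < `|S p.1 sigma - S p.2 sigma|]|%:R <= 2 * 2 ^+ k * e.
    case: p => a b /and3P[/= _ _ ab]; pose W : R := k%:R / 4 ^+ i.
    have W0 : 0 < W by rewrite divr_gt0 ?exprn_gt0.
    have -> : e = expR (- (t i ^+ 2 / (8 * W))).
      have q0 : 2 ^+ i != 0 :> R by rewrite expf_neq0.
      have -> : W = k%:R / (2 ^+ i * 2 ^+ i) by rewrite /W -exprMn -natrM.
      by rewrite /t [2 ^+ i.+1]exprS; congr (expR (- _)); field; rewrite q0 gt_eqF.
    have uW : \sum_l ((a l)%:R - (b l)%:R) ^+ 2 <= W.
      rewrite (_ : \sum_l _ = (hamming a b)%:R).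
        by rewrite ler_pdivlMr ?exprn_gt0 // -natrX -natrM ler_nat mulnC.
      rewrite /hamming -sum1_card natr_sum [RHS]big_mkcond; apply: eq_bigr => l _.
      by rewrite inE; case: (a l) (b l) => -[] /=; rewrite ?subrr ?subr0 ?sub0r ?expr0n ?sqrrN ?expr1n.
    have t0 : 0 <= t i by rewrite !mulr_ge0 // invr_ge0 exprn_ge0.
    apply: le_trans (rademacher_tail t0 W0 uW); rewrite ler_nat.
    apply/subset_leq_card/fintype.subsetP => s; rewrite !inE /S /signed_sum -sumrB.
    by under [X in `|X|]eq_bigr do rewrite -mulrBr.
  (* The two nets give the exponent (8i + 4 + 10h)m, and 8i + 4 + 10h <= 18h(i+1). *)
  have cP : (#|P| <= 2 ^ (18 * (h * m) * i.+1))%N.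
    apply: (@leq_trans (#|N i.+1| * #|N i|)).
      rewrite -cardX; apply/subset_leq_card/fintype.subsetP => -[a b].
      by rewrite !inE => /and3P[/= -> ->].
    have [_ c1 _] := NP i.+1; have [_ c2 _] := NP i.
    apply: leq_trans (leq_mul c1 c2) _; rewrite -expnD leq_exp2l //.
    case/andP: mh => m0 mh; have h0 : (0 < h)%N by apply: leq_trans mh.
    by rewrite -mulnDl mulnA [(18 * h * m * _)%N]mulnAC leq_mul2r; apply/orP; right; nia.
  apply: (@le_trans _ _ ((2 ^ (18 * (h * m) * i.+1))%N%:R * (2 * 2 ^+ k * e))).
    apply: (@le_trans _ _ (\sum_(p in P) 2 * 2 ^+ k * e)).
      apply: (@le_trans _ _ (\sum_(p in P)
        #|[pred sigma | (t i < `|S p.1 sigma - S p.2 sigma|)%R]|)%N%:R).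
        by rewrite ler_nat card_exists_le.
      by rewrite natr_sum; apply: ler_sum => p; apply: tail.
    rewrite sumr_const -[leLHS]mulr_natl ler_wpM2r ?ler_nat //.
    by rewrite !mulr_ge0 ?exprn_ge0 ?expR_ge0.
  have -> : delta * 2 ^+ k * (2 ^+ i.+1)^-1 = 2 * 2 ^+ k * (delta / 2 / 2 ^+ i.+1).
    by field; rewrite expf_neq0.
  rewrite mulrCA ler_pM2l ?mulr_gt0 ?exprn_gt0 //.
  (* As (i+1)^2 >= i+1, the hypothesis bounds the exponent by -(i+1) ln(4/delta). Then
     (delta/4)^(i+1) <= (delta/2)/2^(i+1), which absorbs the factor 2 of the two-sided tail. *)
  apply: (@le_trans _ _ (expR (- (ln (4 / delta) * i.+1%:R)))).
    apply: le_trans (ler_wpM2r (expR_ge0 _) (expR_natl _ _)) _.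
    rewrite -expRD ler_expR.
    have i1 : 1 <= i.+1%:R :> R by rewrite ler1n.
    have ln0 : 0 <= ln (4 / delta) by rewrite ln_ge0 // ler_pdivlMr //; lra.
    have hm0 : 0 <= (h * m)%:R :> R by [].
    rewrite natrM natrM; nra.
  rewrite expRN expRM_natr lnK ?posrE ?divr_gt0 // -[leLHS]exprVn invf_div.
  have -> : delta / 4 = delta / 2 / 2 by field.
  rewrite [leLHS]exprMn exprVn ler_wpM2r ?invr_ge0 ?exprn_ge0 //.
  rewrite exprS -[leRHS]mulr1 ler_wpM2l ?divr_ge0 ?(ltW d0) //.
  by apply: exprn_ile1; [rewrite divr_ge0 // ltW | lra].
have chain sigma j : (j <= k)%N -> (forall i : 'I_k, ~~ bad i sigma) ->
    forall b, b \in N j -> `|S b sigma| <= \sum_(i < j) t i.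
  move=> jk good; elim: j jk => [_|j IH jk] b bN.
    have [N0 _ _] := NP 0%N; move: bN; rewrite N0 inE => /eqP ->.
    by rewrite big_ord0 /S /signed_sum big1 ?normr0 // => l _; rewrite ffunE mulr0.
  have [NA _ _] := NP j.+1; have [_ _ cov] := NP j.
  have [b' b'N bb'] := cov b (fintype.subsetP NA _ bN).
  rewrite big_ord_recr /= addrC -[S b sigma](subrK (S b' sigma)).
  apply: le_trans (ler_normD _ _) _; apply: lerD; last exact: IH (ltnW jk) _ b'N.
  have /existsPn/(_ (b, b')) := good (Ordinal jk).
  by rewrite /= bN b'N bb' /= -leNgt.
apply: (@le_trans _ _ (\sum_(i < k) #|bad i|%:R)).
  rewrite -natr_sum ler_nat.
  apply: leq_trans (card_exists_le predT (fun i : 'I_k => bad i)).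
  apply/subset_leq_card/fintype.subsetP => sigma; rewrite !inE => /exists_inP[a aA aS].
  apply: contraLR aS => /exists_inPn good; rewrite -leNgt.
  apply: (@le_trans _ _ (\sum_(i < k) t i)).
    apply: chain => //; first by move=> i; exact: good.
    have [_ _ /(_ a aA) [b bN ab]] := NP k.
    (* The mesh k/4^k of the last net is below 1. *)
    suff -> : a = b by [].
    have ab0 : hamming a b = 0%N.
      by have := ltn_expl k (isT : (1 < 4)%N); move: ab; case: (hamming a b) => // d; nia.
    apply/ffunP => l; have /card0_eq/(_ l) := ab0.
    by rewrite !inE => /negbFE/eqP.
  rewrite -big_distrr /= [2 * theta]mulrC -[leRHS]mulrA [2 * _]mulrC mulrA.
  by rewrite ler_wpM2l ?sum_nat_half_pow // mulr_ge0.
apply: (@le_trans _ _ (\sum_(i < k) delta * 2 ^+ k * (2 ^+ i.+1)^-1)).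
  by apply: ler_sum => i _; exact: card_bad.
by rewrite -big_distrr /= -[leRHS]mulr1 ler_wpM2l ?sum_half_pow // mulr_ge0 ?exprn_ge0 // ltW.
Qed.

(** * Uniform deviations on a finite probability space *)

Section FiniteSample.
Variables (R : realType) (T I : finType) (mu : T -> R) (F : I -> T -> bool) (k : nat).
Hypotheses (mu_ge0 : forall t, 0 <= mu t) (mu_sum : \sum_t mu t = 1).
Implicit Types (x y : {ffun 'I_k -> T}) (i : I).

Definition sample_weight x : R := \prod_l mu (x l).

Definition mean i : R := \sum_t mu t * (F i t)%:R.

Definition hits i x : R := \sum_l (F i (x l))%:R.

Lemma sample_weight_ge0 x : 0 <= sample_weight x.
Proof. exact: prodr_ge0. Qed.

Lemma sum_sample_weight : \sum_x sample_weight x = 1.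
Proof.
by rewrite -(bigA_distr_bigA (fun _ : 'I_k => mu)) big1 // => l _; rewrite mu_sum.
Qed.

Lemma sample_cov (f : T -> R) (a b : 'I_k) : \sum_t mu t * f t = 0 ->
  \sum_x sample_weight x * (f (x a) * f (x b)) =
  if a == b then \sum_t mu t * f t ^+ 2 else 0.
Proof.
move=> f0; pose G l t := mu t * ((if l == a then f t else 1) * (if l == b then f t else 1)).
have -> : \sum_x sample_weight x * (f (x a) * f (x b)) = \prod_(l < k) \sum_t G l t.
  rewrite bigA_distr_bigA; apply: eq_bigr => x _ /=.
  rewrite !big_split /=; congr (_ * (_ * _)).
    by rewrite -big_mkcond big_pred1_eq.
  by rewrite -big_mkcond big_pred1_eq.
rewrite (bigD1 a) //= {1}/G eqxx; case: eqVneq => ab.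
  rewrite [X in _ * X]big1 ?mulr1.
    by apply: eq_bigr => t _; rewrite expr2.
  move=> l la; rewrite -mu_sum; apply: eq_bigr => t _.
  by rewrite /G -ab (negbTE la) !mulr1.
by under eq_bigr do rewrite mulr1; rewrite f0 mul0r.
Qed.

Lemma mean_itv i : 0 <= mean i <= 1.
Proof.
apply/andP; split; first by apply: sumr_ge0 => t _; exact: mulr_ge0.
rewrite -mu_sum; apply: ler_sum => t _; rewrite -[leRHS]mulr1 ler_wpM2l //.
by rewrite lern1 leq_b1.
Qed.

Lemma hits_variance i :
  \sum_x sample_weight x * (hits i x - k%:R * mean i) ^+ 2 <= k%:R.
Proof.
pose f t : R := (F i t)%:R - mean i.
have f0 : \sum_t mu t * f t = 0.
  under eq_bigr do rewrite mulrBr; rewrite sumrB -big_distrl /= mu_sum mul1r.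
  exact: subrr.
have f1 : \sum_t mu t * f t ^+ 2 <= 1.
  rewrite -mu_sum; apply: ler_sum => t _; rewrite -[leRHS]mulr1 ler_wpM2l //.
  have /andP[m0 m1] := mean_itv i; rewrite /f; case: (F i t) => /=; nra.
have -> : \sum_x sample_weight x * (hits i x - k%:R * mean i) ^+ 2 =
    \sum_(a < k) \sum_(b < k) \sum_x sample_weight x * (f (x a) * f (x b)).
  under [RHS]eq_bigr do rewrite exchange_big /=.
  rewrite exchange_big /=; apply: eq_bigr => x _.
  under eq_bigr do rewrite -big_distrr -big_distrr /=.
  rewrite -big_distrr -big_distrl /= -expr2; congr (_ * _ ^+ 2).
  by rewrite /hits /f sumrB sumr_const card_ord mulr_natl.
apply: (@le_trans _ _ (\sum_(a < k) 1)); last by rewrite sumr_const card_ord.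
apply: ler_sum => a _; under eq_bigr do rewrite sample_cov //.
by rewrite -big_mkcond (big_pred1 a) // => b; rewrite eq_sym.
Qed.

(** Chebyshev's inequality: with variance at most k the exceptional weight is at most 4/(eps^2 k) <=
    1/2. *)
Lemma hits_concentration i (eps : R) : 0 < eps -> 8 <= eps ^+ 2 * k%:R ->
  1 / 2 <= \sum_(x | `|hits i x - k%:R * mean i| <= eps / 2 * k%:R) sample_weight x.
Proof.
move=> eps0 large; pose Q x := `|hits i x - k%:R * mean i| <= eps / 2 * k%:R.
rewrite -[leRHS]/(\sum_(x | Q x) sample_weight x).
have kR0 : 0 < k%:R :> R.
  by rewrite lt_neqAle ler0n andbT eq_sym; apply: contraTneq large => ->; lra.
suff : \sum_(x | ~~ Q x) sample_weight x <= 1 / 2.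
  by have := sum_sample_weight; rewrite (bigID Q) /=; lra.
pose c := eps / 2 * k%:R.
have c0 : 0 < c by rewrite /c mulr_gt0 // divr_gt0.
rewrite -(ler_pM2r (exprn_gt0 2 c0)) big_distrl /=.
apply: (@le_trans _ _ k%:R).
  apply: le_trans (hits_variance i); rewrite [leRHS](bigID Q) /= -[leLHS]add0r.
  apply: lerD; first by apply: sumr_ge0 => x _; rewrite mulr_ge0 ?sample_weight_ge0 ?sqr_ge0.
  apply: ler_sum => x; rewrite /Q -ltNge => /ltW cx.
  by rewrite ler_wpM2l ?sample_weight_ge0 // -[leRHS]real_normK ?num_real // lerXn2r ?nnegrE // ltW.
have -> : 1 / 2 * c ^+ 2 = (eps ^+ 2 * k%:R) / 8 * k%:R by rewrite /c; field.
by rewrite -[leLHS]mul1r ler_wpM2r //; lra.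
Qed.

Definition signed_dev i (sigma : {ffun 'I_k -> bool}) x y : R :=
  \sum_l (-1) ^+ sigma l * ((F i (x l))%:R - (F i (y l))%:R).

Definition ghost_prob (c : R) (sigma : {ffun 'I_k -> bool}) : R :=
  \sum_x \sum_y sample_weight x * sample_weight y *
    ([exists i, c < `|signed_dev i sigma x y|])%:R.

(* Exchanging the two samples where sigma is true preserves the weights. *)
Lemma ghost_prob_sign c sigma : ghost_prob c sigma = ghost_prob c [ffun=> false].
Proof.
pose swap (p : {ffun 'I_k -> T} * {ffun 'I_k -> T}) :
    {ffun 'I_k -> T} * {ffun 'I_k -> T} :=
  ([ffun l => if sigma l then p.2 l else p.1 l],
   [ffun l => if sigma l then p.1 l else p.2 l]).
have swapK : involutive swap.
  move=> [x y]; congr (_, _); apply/ffunP => l; rewrite !ffunE /= ?ffunE;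
  by case: (sigma l).
rewrite /ghost_prob !pair_big /= [RHS](reindex_inj (inv_inj swapK)) /=.
apply: eq_bigr => -[x y] _ /=; congr (_ * _).
  rewrite /sample_weight -!big_split /=; apply: eq_bigr => l _.
  by rewrite !ffunE /=; case: (sigma l); rewrite // mulrC.
congr (nat_of_bool _)%:R; apply: eq_existsb => i; congr (_ < `|_|).
apply: eq_bigr => l _; rewrite !ffunE /=; case: (sigma l) => /=.
  by rewrite expr1 expr0 mulN1r mul1r opprB.
by [].
Qed.

(** If x deviates by eps k at i, then an independent ghost sample y is within eps k/2 of the mean at
    this same i with probability at least 1/2, and x and y differ there by more than eps k/2. *)
Lemma symmetrization (eps : R) : 0 < eps -> 8 <= eps ^+ 2 * k%:R ->
  \sum_(x | [exists i, eps * k%:R < `|hits i x - k%:R * mean i|]) sample_weight x <=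
  2 * ghost_prob (eps / 2 * k%:R) [ffun=> false].
Proof.
move=> eps0 large; rewrite /ghost_prob big_distrr /= [leRHS](bigID
  (fun x => [exists i, eps * k%:R < `|hits i x - k%:R * mean i|])) /= -[leLHS]addr0.
apply: lerD; last first.
  apply: sumr_ge0 => x _; rewrite mulr_ge0 //; apply: sumr_ge0 => y _.
  by rewrite !mulr_ge0 ?sample_weight_ge0.
apply: ler_sum => x /existsP [i dev].
under eq_bigr do rewrite -mulrA; rewrite -big_distrr /= mulrCA.
rewrite -[leLHS]mulr1 ler_wpM2l ?sample_weight_ge0 //.
have half := hits_concentration i eps0 large.
suff : \sum_(y | `|hits i y - k%:R * mean i| <= eps / 2 * k%:R) sample_weight y <=
    \sum_y sample_weight y *
      ([exists i, eps / 2 * k%:R < `|signed_dev i [ffun=> false] x y|])%:R by lra.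
rewrite big_mkcond; apply: ler_sum => y _; case: ifP => [close|_]; last first.
  by rewrite mulr_ge0 ?sample_weight_ge0.
rewrite (_ : [exists i, _] = true) ?mulr1 //; apply/existsP; exists i.
have -> : signed_dev i [ffun=> false] x y =
    (hits i x - k%:R * mean i) - (hits i y - k%:R * mean i).
  rewrite /signed_dev; under eq_bigr do rewrite ffunE expr0 mul1r.
  by rewrite sumrB opprB addrA subrK.
have := lerB_normD (hits i x - k%:R * mean i) (- (hits i y - k%:R * mean i)).
rewrite normrN; lra.
Qed.

(** Average over the signs, then fix both samples: a signed difference above c forces the signed sum
    of one sample above c/2, whence the factor 2. *)
Lemma ghost_prob_le (c delta : R) :
  (forall x, #|[pred sigma | [exists i,
     c / 2 < `|signed_sum (fun l => (F i (x l))%:R) sigma|]]|%:R <= delta * 2 ^+ k) ->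
  ghost_prob c [ffun=> false] <= 2 * delta.
Proof.
move=> frac.
have -> : ghost_prob c [ffun=> false] =
    (2 ^+ k)^-1 * \sum_(sigma : {ffun 'I_k -> bool}) ghost_prob c sigma.
  under eq_bigr do rewrite ghost_prob_sign.
  rewrite sumr_const card_ffun card_bool card_ord -[X in _ * X]mulr_natl natrX.
  by rewrite mulKf // expf_neq0.
rewrite -ler_pdivlMl ?invr_gt0 ?exprn_gt0 // invrK /ghost_prob exchange_big /=.
(* Inserting total weights 1 allows a comparison under the sums over x and y. *)
have one (G : R) : G = \sum_x sample_weight x * G.
  by rewrite -big_distrl /= sum_sample_weight mul1r.
rewrite [leRHS]one; apply: ler_sum => x _; rewrite exchange_big /= [X in _ * X]one big_distrr /=.
apply: ler_sum => y _; rewrite mulrA -big_distrr /= ler_wpM2l ?mulr_ge0 ?sample_weight_ge0 //.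
rewrite -natr_sum.
pose E x := [pred sigma | [exists i,
  c / 2 < `|signed_sum (fun l => (F i (x l))%:R : R) sigma|]].
apply: (@le_trans _ _ (#|E x| + #|E y|)%:R).
  rewrite ler_nat -cardUI; apply: leq_trans (leq_addr _ _).
  rewrite -sum1_card big_mkcond [leqRHS]big_mkcond; apply: leq_sum => sigma _ /=.
  case: existsP => // -[i dev]; rewrite inE ifT //; apply/orP.
  have [xs|xs] := ltP (c / 2) `|signed_sum (fun l => (F i (x l))%:R : R) sigma|.
    by left; rewrite inE; apply/existsP; exists i.
  right; rewrite inE; apply/existsP; exists i; rewrite ltNge; apply/negP => ys.
  move: dev; rewrite ltNge => /negP[].
  rewrite (_ : signed_dev i sigma x y = signed_sum (fun l => (F i (x l))%:R) sigma -
    signed_sum (fun l => (F i (y l))%:R) sigma); last first.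
    by rewrite /signed_sum -sumrB; apply: eq_bigr => l _; rewrite mulrBr.
  by apply: le_trans (ler_normB _ _) _; lra.
by rewrite natrD; have := frac x; have := frac y; rewrite /E; lra.
Qed.
End FiniteSample.

Lemma finite_uniform_deviation (R : realType) (T I : finType) (mu : T -> R)
    (F : I -> T -> bool) (k m h : nat) (eps delta : R) :
  (forall t, 0 <= mu t) -> \sum_t mu t = 1 -> (0 < m <= h)%N ->
  (forall s (z : 'I_s -> T), (0 < s)%N ->
    (#|[set [ffun l => F i (z l)] | i in I]%SET| <= (s * 2 ^ h) ^ m)%N) ->
  0 < eps -> 0 < delta < 1 ->
  18 * (h * m)%:R + ln (16 / delta) <= eps ^+ 2 * k%:R / 2048 ->
  \sum_(x : {ffun 'I_k -> T} |
      [exists i, eps * k%:R < `|hits R F i x - k%:R * mean mu F i|])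
    sample_weight mu x <= delta.
Proof.
move=> mu_ge0 mu_sum mh growth eps0 /andP[d0 d1] large.
have ln0 : 0 <= ln (16 / delta) by rewrite ln_ge0 // ler_pdivlMr //; lra.
have hm1 : 1 <= (h * m)%:R :> R.
  by rewrite ler1n muln_gt0; case/andP: mh => m0 mh; rewrite m0 (leq_trans m0 mh).
have kR0 : 0 < k%:R :> R.
  rewrite lt_neqAle ler0n andbT eq_sym; apply: contraTneq large => ->.
  rewrite mulr0 mul0r -ltNge; lra.
have large8 : 8 <= eps ^+ 2 * k%:R by lra.
apply: le_trans (symmetrization F mu_ge0 mu_sum eps0 large8) _.
suff : @ghost_prob R T I mu F k (eps / 2 * k%:R) [ffun=> false] <= 2 * (delta / 4).
  by rewrite -(ler_pM2l (ltr0Sn R 1)) => /le_trans; apply; lra.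
apply: ghost_prob_le => // x.
pose A := [set [ffun l => F i (x l)] | i in I]%SET.
have growthA : poly_growth m h A.
  move=> s u s0; apply: leq_trans (growth s (x \o u) s0).
  apply/subset_leq_card/fintype.subsetP => a /imsetP[b /imsetP[i iI ->] ->].
  by apply/imsetP; exists i => //; apply/ffunP => l; rewrite !ffunE.
have kN : (0 < k)%N by rewrite -(ltr0n R).
have d4 : 0 < delta / 4 < 1 by apply/andP; split; lra.
(* Chaining with theta = eps/8 has threshold 2 theta k = eps k/4, half the ghost threshold, and
   theta^2/32 = eps^2/2048. Symmetrization and the pair of samples each double delta/4. *)
have eps8 : 0 <= eps / 8 by lra.
apply: le_trans (chaining kN mh growthA d4 eps8 _); last first.
  have -> : 4 / (delta / 4) = 16 / delta by field; rewrite gt_eqF.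
  by apply: le_trans large _; rewrite le_eqVlt; apply/orP; left; apply/eqP; field.
have -> : 2 * (eps / 8) * k%:R = eps / 2 * k%:R / 2 by field.
rewrite ler_nat; apply/subset_leq_card/fintype.subsetP => sigma.
rewrite !inE => /existsP[i dev]; apply/exists_inP; exists [ffun l => F i (x l)].
  by apply/imsetP; exists i.
rewrite (_ : signed_sum _ _ = signed_sum (fun l => (F i (x l))%:R) sigma) //.
by apply: eq_bigr => l _; rewrite ffunE.
Qed.

(** * Sequential sales *)

Local Open Scope classical_set_scope.
Local Open Scope ring_scope.

Lemma demand_ext (R : realType) (m : nat) (v : valuation R m) (p q : 'I_m -> R) M :
  (forall B B', (utility v p B' <= utility v p B) = (utility v q B' <= utility v q B)) ->
  demand v p M = demand v q M.
Proof.
move=> pq; apply/setP => B; rewrite !inE; congr andb.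
by apply: eq_forallb => B'; rewrite pq.
Qed.

Lemma sold_ext (R : realType) (n m : nat) (v : profile R n m) (p q : 'I_m -> R) j :
  (forall i M, demand (tnth v i) p M = demand (tnth v i) q M) ->
  sold p j v = sold q j v.
Proof.
move=> pq; apply/propext; split=> -[X sX jX]; exists X => // i.
  by rewrite -pq; exact: sX.
by rewrite pq; exact: sX.
Qed.

Lemma card_imset_le (I T T' : finType) (f : I -> T) (g : I -> T') :
  (forall i i', g i = g i' -> f i = f i') ->
  (#|[set f i | i in I]%SET| <= #|[set g i | i in I]%SET|)%N.
Proof.
move=> gf; pose F y := if [pick i | g i == y] is Some i then Some (f i) else None.
rewrite -(card_imset _ (@Some_inj _ : injective (@Some T))).
apply: leq_trans (leq_imset_card F _).
apply/subset_leq_card/fintype.subsetP => _ /imsetP[_ /imsetP[i _ ->] ->].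
apply/imsetP; exists (g i); first exact/imset_f.
rewrite /F; case: pickP => [i' /eqP/gf -> //|/(_ i)].
by rewrite eqxx.
Qed.

Section SalePatterns.
Variables (R : realType) (n m s : nat) (z : 'I_s -> profile R n m).

Let index : finType := ('I_s * 'I_n * {set 'I_m} * {set 'I_m})%type.

Definition comparison_functional (c : index) : ('I_m -> R) * R :=
  let: (l, i, B, B') := c in
  (fun j => (j \in B)%:R - (j \in B')%:R, tnth (z l) i B' - tnth (z l) i B).

Lemma comparison_functionalE l i B B' p :
  (affine (comparison_functional (l, i, B, B')) p <= 0) =
  (utility (tnth (z l) i) p B' <= utility (tnth (z l) i) p B).
Proof.
rewrite /utility -[RHS]subr_le0; congr (_ <= 0); rewrite /affine /=.
under eq_bigr do rewrite mulrBl.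
have mem_sum (C : {set 'I_m}) : \sum_j (j \in C)%:R * p j = \sum_(j in C) p j.
  by rewrite [RHS]big_mkcond; apply: eq_bigr => j _; case: (_ \in _); rewrite ?mul1r ?mul0r.
by rewrite sumrB !mem_sum; ring.
Qed.

(** The index is a pair of a price and an item, so that one deviation bound serves all items, at the
    cost of the factor m. *)
Lemma card_sold_patterns (I : finType) (price : I -> 'I_m -> R) :
  (#|[set [ffun l => `[< sold (price ij.1) ij.2 (z l) >]] |
      ij in ((I * 'I_m)%type : finType)]%SET| <=
   m * (s * n * 2 ^ m * 2 ^ m).+1 ^ m)%N.
Proof.
pose L := [seq comparison_functional c | c <- enum (@predT index)].
pose N := (s * n * 2 ^ m * 2 ^ m)%N.
have card_sets : #|{set 'I_m}| = (2 ^ m)%N.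
  by rewrite -cardsT -powersetT card_powerset cardsT card_ord.
have sL : size L = N by rewrite size_map -cardE !card_prod !card_ord !card_sets.
have sH p : size (halfspaces L p) == N by rewrite size_map sL.
pose pat i := Tuple (sH (price i)).
have patE i i' j l : pat i = pat i' -> sold (price i) j (z l) = sold (price i') j (z l).
  move=> /(congr1 val) /=; rewrite /halfspaces -!map_comp => /eq_in_map eq_pat.
  apply: sold_ext => a M; apply: demand_ext => B B'.
  rewrite -!comparison_functionalE.
  by apply: (eq_pat ((l, a, B, B') : index)); rewrite -enumT mem_enum.
apply: leq_trans (@card_imset_le _ _ _ _ (fun ij : I * 'I_m => (pat ij.1, ij.2)) _) _.
  move=> [i j] [i' j'] /= [pp ->]; apply/ffunP => l; rewrite !ffunE.
  by rewrite (patE i i') //; apply: val_inj.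
apply: (@leq_trans #|finset.setX [set pat i | i in I]%SET [set: 'I_m]%SET|).
  apply/subset_leq_card/fintype.subsetP => _ /imsetP[[i j] _ ->].
  by rewrite !inE andbT; exact: imset_f.
rewrite cardsX cardsT card_ord mulnC leq_mul2l; apply/orP; right.
apply: (@card_halfspaces _ _ _ L) => // t /imsetP[i _ ->].
by exists (price i).
Qed.

End SalePatterns.

(** The term 2m counts pairs of bundles, the logarithm the agents; one unit absorbs the successor in
    the pattern count, the other the factor m <= 2^m. *)
Definition profile_log (n m : nat) : nat := (2 * m + 2 + up_log 2 n)%N.

Lemma sold_patterns_growth (n m s : nat) : (0 < n)%N -> (0 < m)%N -> (0 < s)%N ->
  (m * (s * n * 2 ^ m * 2 ^ m).+1 ^ m <= (s * 2 ^ profile_log n m) ^ m)%N.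
Proof.
move=> n0 m0 s0; apply: (@leq_trans (2 ^ m * (s * 2 ^ (profile_log n m).-1) ^ m)).
  apply: leq_mul; first exact/ltnW/ltn_expl.
  rewrite leq_exp2r //; have -> : (profile_log n m).-1 = (m + m + up_log 2 n).+1.
    by rewrite /profile_log; lia.
  rewrite expnS mulnCA mul2n -addnn -addn1; apply: leq_add.
    rewrite !expnD -!mulnA leq_mul2l; apply/orP; right.
    by rewrite [leqRHS]mulnA [leqRHS]mulnC leq_mul2r up_logP ?orbT.
  by rewrite muln_gt0 s0 expn_gt0.
rewrite -expnMn leq_exp2r // mulnCA leq_mul2l -expnS prednK ?leqnn ?orbT //.
by rewrite /profile_log addnS.
Qed.

(** * Continuity of the sale probabilities *)

Lemma exists_large_event d (T : measurableType d) (R : realType)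
    (P : probability T R) (F : (set T)^nat) (eps : R) :
  (forall N, measurable (F N)) -> nondecreasing_seq F ->
  {ae P, forall x, (\bigcup_N F N) x} -> 0 < eps ->
  exists N, (P (~` F N) < eps%:E)%E.
Proof.
move=> mF ndF aeF eps0; apply: contrapT => /forallNP large.
have mU : measurable (\bigcup_N F N) by exact: bigcup_measurable.
have mC N : measurable (~` F N) by exact: measurableC.
have mI : measurable (\bigcap_N ~` F N) by exact: bigcap_measurable.
have P0 : P (\bigcap_N ~` F N) = 0%E.
  rewrite -setC_bigcup; apply/negligibleP; first exact: measurableC.
  by apply: negligibleS aeF.
have : P \o (fun N => ~` F N) @ \oo --> (0 : \bar R)%E.
  rewrite -P0; apply: nonincreasing_cvg_mu => //.
    by rewrite (le_lt_trans (probability_le1 _ _)) ?ltry.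
  by move=> a b ab; apply/subsetPset/subsetC/subsetPset/ndF.
move=> /[dup] cP /cvg_lim -/(_ (@ereal_hausdorff R)) limP.
have : (eps%:E <= limn (P \o (fun N => ~` F N)))%E.
  apply: lime_ge; first by apply/cvg_ex; exists 0%E.
  by near=> N; rewrite leNgt; apply/negP/large.
by rewrite limP lee_fin leNgt eps0.
Unshelve. all: by end_near. Qed.

Section SaleContinuity.
Variables (R : realType) (n m : nat).
Implicit Types (v : profile R n m) (p q : 'I_m -> R).

(** Quantitative uniqueness of demand: the best bundle wins by at least 1/(N+1). All sets M are
    included because what a buyer finds varies with the profile. *)
Definition gap_event p (N : nat) : set (profile R n m) :=
  \bigcap_(i in [set: 'I_n]) \bigcap_(M in [set: {set 'I_m}])
  \bigcup_(B in [set B : {set 'I_m} | B \subset M])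
  \bigcap_(B' in [set B' : {set 'I_m} | (B' \subset M) && (B' != B)])
    ((fun v => tnth v i) @^-1`
      [set w | utility w p B' + N.+1%:R^-1 <= utility w p B]).

Lemma measurable_gap_event p N : measurable (gap_event p N).
Proof.
apply: fin_bigcap_measurable => // i _; apply: fin_bigcap_measurable => // M _.
apply: fin_bigcup_measurable => // B _; apply: fin_bigcap_measurable => // B' _.
rewrite -[X in measurable X]setTI; apply: measurable_tnth => //.
rewrite -[X in measurable X]setTI.
apply: (@measurable_fun_le _ _ R setT (fun w => utility w p B' + N.+1%:R^-1)
  (fun w => utility w p B)) => //; last exact: measurable_utility.
by apply: measurable_funD; [exact: measurable_utility|exact: measurable_cst].
Qed.

Lemma nondecreasing_gap_event p : nondecreasing_seq (gap_event p).
Proof.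
move=> a b ab; apply/subsetPset => v gv i _ M _.
have [B BM gB] := gv i I M I; exists B => // B' B'M.
apply: le_trans (gB _ B'M); rewrite lerD2l lef_pV2 ?posrE //.
by rewrite ler_nat.
Qed.

Lemma demand_set1 (w : valuation R m) p (M B : {set 'I_m}) : B \subset M ->
  (forall B' : {set 'I_m}, B' \subset M -> B' != B -> utility w p B' < utility w p B) ->
  demand w p M = [set B]%SET.
Proof.
move=> BM best; apply/setP => B'; rewrite !inE; apply/idP/eqP => [|->].
  case/andP=> B'M /forallP/(_ B)/implyP/(_ BM) le; apply/eqP; apply: contraTT le.
  by move=> neq; rewrite -ltNge best.
rewrite BM /=; apply/forallP => C; apply/implyP => CM.
by have [->//|neq] := eqVneq C B; exact/ltW/best.
Qed.

Lemma gap_event_cover p v :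
  (forall i M, #|demand (tnth v i) p M| = 1%N) -> (\bigcup_N gap_event p N) v.
Proof.
move=> single; suff : \forall N \near \oo, gap_event p N v.
  by case=> N _ /(_ N (leqnn N)) gv; exists N.
suff : \forall N \near \oo, forall i (M : {set 'I_m}), exists2 B : {set 'I_m}, B \subset M &
    forall B' : {set 'I_m}, (B' \subset M) && (B' != B) ->
      utility (tnth v i) p B' + N.+1%:R^-1 <= utility (tnth v i) p B.
  by move=> near_B; apply: filterS near_B => N gv i _ M _; have [B BM gB] := gv i M; exists B.
apply: filter_forall => i; apply: filter_forall => M.
have /eqP/cards1P[B dB] := single i M.
have : B \in demand (tnth v i) p M by rewrite dB inE.
rewrite inE => /andP[BM /forallP Bmax].
suff : \forall N \near \oo, forall B' : {set 'I_m}, (B' \subset M) && (B' != B) ->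
      utility (tnth v i) p B' + N.+1%:R^-1 <= utility (tnth v i) p B.
  by move=> near_B; apply: filterS near_B => N gB; exists B.
apply: filter_forall => B'; have [/andP[B'M neq]|] := boolP (_ && _); last first.
  by move=> _; apply: nearW.
have lt : utility (tnth v i) p B' < utility (tnth v i) p B.
  rewrite lt_neqAle (implyP (Bmax B')) // andbT; apply: contraNneq neq => eq_u.
  rewrite -finset.in_set1 -dB inE B'M; apply/forallP => C; rewrite eq_u.
  exact: Bmax.
have e0 : 0 < utility (tnth v i) p B - utility (tnth v i) p B' by rewrite subr_gt0.
near=> N; move=> _; rewrite addrC -lerBrDr; apply: ltW; near: N.
exact: (near_infty_natSinv_lt (PosNum e0)).
Unshelve. all: by end_near. Qed.

Lemma utility_dist (w : valuation R m) p q B :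
  `|utility w q B - utility w p B| <= \sum_j `|q j - p j|.
Proof.
rewrite /utility (_ : _ - _ = \sum_(j in B) (p j - q j)); last by rewrite sumrB; ring.
apply: le_trans (ler_norm_sum _ _ _) _; rewrite big_mkcond; apply: ler_sum => j _.
by case: ifP => // _; rewrite distrC.
Qed.

(** Each utility moves by at most the l1 distance of the prices, hence a difference of two by less
    than the gap. *)
Lemma gap_event_demand p q N v : gap_event p N v ->
  2 * \sum_j `|q j - p j| < N.+1%:R^-1 ->
  forall i M, demand (tnth v i) q M = demand (tnth v i) p M.
Proof.
move=> gv close i M; have [B BM gB] := gv i I M I.
have N0 : 0 < N.+1%:R^-1 :> R by rewrite invr_gt0.
have demand_p : demand (tnth v i) p M = [set B]%SET.
  apply: demand_set1 => // B' B'M neq.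
  by have := gB B'; rewrite /= B'M neq => /(_ isT); apply: lt_le_trans; rewrite ltrDl.
rewrite demand_p; apply: demand_set1 => // B' B'M neq.
have := gB B'; rewrite /= B'M neq => /(_ isT); move: close.
have := utility_dist (tnth v i) p q B; have := utility_dist (tnth v i) p q B'.
move: (N.+1%:R^-1) => e; rewrite !ler_norml => /andP[_ h1] /andP[h2 _] c g.
lra.
Qed.

Definition sale_probR (D : probability (profile R n m) R) p j : R :=
  fine (sale_prob D p j).

Lemma sale_probRE D p j : (sale_probR D p j)%:E = sale_prob D p j.
Proof. by rewrite fineK // fin_num_measure //; exact: measurable_sold. Qed.

Lemma ae_unique_demand (D : probability (profile R n m) R) p :
  generic_profile D -> price_vector p ->
  {ae D, forall v, forall i M, #|demand (tnth v i) p M| = 1%N}.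
Proof.
move=> gen pp; apply: filter_forall => i; apply: filter_forall => M.
have [A [mA PA subA]] := gen i p pp M.
exists (agent i @^-1` A); split => //.
  by rewrite -[X in measurable X]setTI; exact: measurable_tnth.
by move=> v /= nv; apply: subA.
Qed.

(** By genericity at p, some gap 1/(N+1) is available outside an event of probability less than eps;
    on the rest, the sale is the same at all nearby prices. *)
Lemma sale_prob_continuous (D : probability (profile R n m) R) p (eps : R) :
  generic_profile D -> price_vector p -> 0 < eps ->
  exists2 r : R, 0 < r & forall q j, (forall i, `|q i - p i| < r) ->
    `|sale_probR D q j - sale_probR D p j| <= eps.
Proof.
move=> gen pp eps0.
have aeG : {ae D, forall v, (\bigcup_N gap_event p N) v}.
  by apply: filterS (ae_unique_demand gen pp) => v; exact: gap_event_cover.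
have [N DN] := exists_large_event (@measurable_gap_event p)
  (@nondecreasing_gap_event p) aeG eps0.
(* Taking m+1 in place of m makes 2 m r < 1/(N+1) strict. *)
exists (2 * m.+1%:R * N.+1%:R)^-1; first by rewrite invr_gt0 !mulr_gt0.
move=> q j close.
have small : 2 * \sum_j `|q j - p j| < N.+1%:R^-1.
  apply: (@le_lt_trans _ _ (2 * (\sum_(j < m) (2 * m.+1%:R * N.+1%:R)^-1))).
    by rewrite ler_pM2l //; apply: ler_sum => l _; exact/ltW/close.
  rewrite sumr_const card_ord -[X in 2 * X]mulr_natl.
  have -> : 2 * (m%:R * (2 * m.+1%:R * N.+1%:R)^-1) = m%:R / m.+1%:R / N.+1%:R :> R.
    have : m.+1%:R != 0 :> R by rewrite pnatr_eq0.
    have : N.+1%:R != 0 :> R by rewrite pnatr_eq0.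
    by move: (N.+1%:R : R) (m.+1%:R : R) => a b a0 b0; field; rewrite a0 b0.
  rewrite ltr_pdivrMr // mulVf ?pnatr_eq0 // ltr_pdivrMr // mul1r ltr_nat.
  exact: ltnSn.
have same v : gap_event p N v -> sold q j v = sold p j v.
  by move=> gv; apply: sold_ext => i M; exact: gap_event_demand gv small i M.
have mg := measurableC (measurable_gap_event p N).
have half p1 p2 : (forall v, gap_event p N v -> sold p1 j v = sold p2 j v) ->
    sale_probR D p1 j <= sale_probR D p2 j + eps.
  move=> same12; rewrite -lee_fin EFinD !sale_probRE.
  apply: le_trans (leeD (lexx _) (ltW DN)).
  apply: le_trans (measureU2 _ (measurable_sold _ _) mg).
  apply: le_measure; rewrite ?inE; [exact: measurable_sold| |].
    by apply: measurableU => //; exact: measurable_sold.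
  move=> v sv; have [gv|gv] := pselect (gap_event p N v); last by right.
  by left; rewrite -same12.
have h1 := half q p same; have h2 := half p q (fun v gv => esym (same v gv)).
by rewrite ler_norml; apply/andP; split; lra.
Qed.

End SaleContinuity.

(** * Existence of approximate median prices *)

Section MedianExistence.
Variables (R : realType) (n m : nat) (D : probability (profile R n m.+1) R).
Hypothesis gen : generic_profile D.

Definition grid_price (M : nat) (x : {ffun 'I_m.+1 -> nat}) : 'I_m.+1 -> R :=
  fun j => (x j)%:R / M.+1%:R.

Lemma grid_price_ge0 M x : price_vector (grid_price M x).
Proof. by move=> j; rewrite divr_ge0. Qed.

(** A buyer of j cannot gain by dropping it, so that the price of j is at most the value of the
    whole set; with probability above 1/2 no agent's value exceeds some bound N+1. *)
Lemma sale_prob_high_price : exists2 K : nat, (0 < K)%N &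
  forall p j, K%:R <= p j -> sale_probR D p j < 1 / 2.
Proof.
pose F (N : nat) : set (profile R n m.+1) := \bigcap_(i in [set: 'I_n])
  ((fun v => tnth v i) @^-1` [set w : valuation R m.+1 | w [set: 'I_m.+1]%SET <= N.+1%:R]).
have mF N : measurable (F N).
  apply: fin_bigcap_measurable => // i _.
  rewrite -[X in measurable X]setTI; apply: measurable_tnth => //.
  rewrite -[X in measurable X]setTI.
  apply: (@measurable_fun_le _ _ R setT (fun w : valuation R m.+1 => w [set: 'I_m.+1]%SET) (fun=> N.+1%:R)) => //.
  exact: measurable_eval.
have ndF : nondecreasing_seq F.
  move=> a b ab; apply/subsetPset => v Fv i _; apply: le_trans (Fv i I) _.
  by rewrite ler_nat.
have aeF : {ae D, forall v, (\bigcup_N F N) v}.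
  apply: aeW => v; suff : \forall N \near \oo, F N v.
    by case=> N _ /(_ N (leqnn N)) Fv; exists N.
  suff : \forall N \near \oo, forall i, tnth v i [set: 'I_m.+1]%SET <= N.+1%:R.
    by move=> near_F; apply: filterS near_F => N Fv i _; exact: Fv.
  apply: filter_forall => i; near=> N; apply: (@le_trans _ _ N%:R); last by rewrite ler_nat.
  by near: N; exact: nbhs_infty_ger.
have half0 : 0 < 1 / 2 :> R by [].
have [N DN] := exists_large_event mF ndF aeF half0.
exists N.+2 => // p j pj; rewrite -lte_fin sale_probRE; apply: le_lt_trans DN.
apply: le_measure; rewrite ?inE; [exact: measurable_sold|exact: measurableC|].
move=> v [X sX [i jX]] /(_ i I) /=; apply/negP; rewrite -ltNge.
apply: (@lt_le_trans _ _ (p j)); first by apply: lt_le_trans pj; rewrite ltr_nat.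
have := sX i; rewrite inE => /andP[XM /forallP/(_ (X i :\ j)%SET)].
rewrite (fintype.subset_trans (subD1set _ _) XM) /= /utility.
rewrite [in X in _ <= X](big_setD1 j) //=.
have := valuation_ge0 (tnth v i) (X i :\ j)%SET.
have := valuation_mono (tnth v i) (finset.subsetT (X i)).
lra.
Unshelve. all: by end_near. Qed.

(** Continuity is only pointwise, so that a fine mesh does not by itself make the corners of a cell
    comparable. Cells are therefore taken near a cluster point p of their lower corners, and
    compared through p. *)
Lemma exists_approx_median (eps : R) : 0 < eps -> exists M x,
  forall j, sale_probR D (grid_price M x) j <= 1 / 2 + eps /\
    (0 < grid_price M x j -> 1 / 2 - eps <= sale_probR D (grid_price M x) j).
Proof.
move=> eps0; have [K K0 highK] := sale_prob_high_price.
have cell M : exists q : {ffun 'I_m.+1 -> nat}, (forall i, (q i < K * M.+1)%N) /\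
    forall i (b : bool), exists2 x : {ffun 'I_m.+1 -> nat},
      (forall j, (q j <= x j <= q j + 1)%N) &
      (0 < x i)%N && (sale_probR D (grid_price M x) i < 1 / 2) = b.
  have [||x i xi|q [qK both]] := @kuhn_lemma m (K * M.+1) (fun x i =>
    (0 < x i)%N && (sale_probR D (grid_price M x) i < 1 / 2)).
  - by rewrite muln_gt0 K0.
  - by move=> x i ->.
  - rewrite xi muln_gt0 K0 /=; apply: highK.
    by rewrite /grid_price xi natrM mulfK // pnatr_eq0.
  by exists q; split=> // i b; have [x qx lx] := both i b; exists x => // j; case: (qx j).
have [q qP] := choice cell.
pose u M : 'rV[R]_m.+1 := \row_j grid_price M (q M) j.
have /(_ (u @ \oo)) := @rV_compact R m.+1 (fun=> `[0, K%:R]%classic)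
  (fun=> @segment_compact R 0 K%:R).
case=> [|c [/= c0K clus]].
  exists 0%N => // M _ /= j; rewrite mxE in_itv /= grid_price_ge0 /=.
  have [qK _] := qP M; rewrite /grid_price ler_pdivrMr // -natrM ler_nat.
  exact/ltnW/qK.
pose p j := c ord0 j.
have pp : price_vector p by move=> j; have := c0K j; rewrite /= in_itv /= => /andP[].
have e2 : 0 < eps / 2 by rewrite divr_gt0.
have [r r0 cont] := sale_prob_continuous gen pp e2.
have r2 : 0 < r / 2 by rewrite divr_gt0.
(* A mesh below r/2 and a lower corner within r/2 of [c] put all corners of the cell within r of
   [c]. *)
have nearA : (u @ \oo) [set y | exists2 M, M.+1%:R^-1 < r / 2 & y = u M].
  have [M0 _ M0P] := near_infty_natSinv_lt (PosNum r2).
  by exists M0 => // M M0M; exists M => //; exact: M0P.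
have [_ [[M Mr ->] ball_u]] := clus _ _ nearA (nbhsx_ballx c (r / 2) r2).
have [_ both] := qP M.
have close (x : {ffun 'I_m.+1 -> nat}) : (forall j, (q M j <= x j <= q M j + 1)%N) ->
    forall j, `|sale_probR D (grid_price M x) j - sale_probR D p j| <= eps / 2.
  move=> qx j; apply: cont => i; have [_ /(_ ord0 i)] := ball_u; rewrite /ball /= mxE => cu.
  have : `|grid_price M x i - grid_price M (q M) i| <= M.+1%:R^-1.
    rewrite /grid_price -mulrBl normrM [`|_^-1|]ger0_norm ?invr_ge0 //.
    rewrite -[leRHS]mul1r ler_wpM2r ?invr_ge0 //.
    have /andP[q1 q2] := qx i; rewrite -natrB // normr_nat -[leRHS]/(1%:R) ler_nat.
    by rewrite leq_subLR.
  move: cu Mr; rewrite /p; move: (M.+1%:R^-1) => e.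
  have -> : grid_price M x i - c ord0 i = (grid_price M x i - grid_price M (q M) i) -
    (c ord0 i - grid_price M (q M) i) by ring.
  by have := ler_normB (grid_price M x i - grid_price M (q M) i)
    (c ord0 i - grid_price M (q M) i); lra.
exists M, (q M) => j.
have cq : `|sale_probR D (grid_price M (q M)) j - sale_probR D p j| <= eps / 2.
  by apply: close => l; rewrite leqnn leq_addr.
split.
  (* The two comparisons, from this corner to p and from p to [q M], cost eps/2 each. *)
  have [x qx /andP[_ lx]] := both j true; have := close x qx j.
  by move: cq lx; rewrite !ler_norml => /andP[_ ?] ? /andP[? _]; lra.
move=> qj; have [x qx] := both j false; have := close x qx j.
(* As [q M] is the lower corner, a positive price there is positive at every corner, and a false
   label then means sale probability at least 1/2. *)
have -> : (0 < x j)%N.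
  have /andP[q1 _] := qx j; apply: leq_trans q1; rewrite lt0n; apply: contraTneq qj => qj0.
  by rewrite /grid_price qj0 mul0r ltxx.
move=> cx /negbT; rewrite -leNgt => lx.
by move: cq cx; rewrite !ler_norml => /andP[? _] /andP[_ ?]; lra.
Qed.

End MedianExistence.

(** * The sampling procedure *)

Lemma finite_law d (T : measurableType d) (R : realType) (P : probability T R)
    (V : finType) (g : T -> V) (S : pred V) :
  (forall t, measurable (g @^-1` [set t])) ->
  fine (P [set w | S (g w)]) = \sum_(t | S t) fine (P (g @^-1` [set t])).
Proof.
move=> mg; have -> : [set w | S (g w)] =
    \bigcup_(t in [set` enum S]) g @^-1` [set t].
  apply/seteqP; split=> [w Sw|w [t tS /= gt]].
    by exists (g w) => //=; rewrite mem_enum.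
  by move: tS; rewrite /= mem_enum -gt.
rewrite measure_fin_bigcup //; last first.
  by move=> t t' _ _ [w [/= gt gt']]; rewrite -gt -gt'.
rewrite -fsbig_seq ?enum_uniq // big_enum_cond /=.
rewrite (eq_bigr (fun t => (fine (P (g @^-1` [set t])))%:E)); last first.
  by move=> t _; rewrite fineK // fin_num_measure.
rewrite sumEFin /=.
by apply: eq_bigl => t; rewrite andbT.
Qed.

Section UniformSaleDeviation.
Variables (R : realType) (n m : nat) (D : probability (profile R n m) R).
Variables (price : nat -> 'I_m -> R) (N : nat).

Let pattern : finType := {ffun 'I_N * 'I_m -> bool}.

Definition sale_pattern (v : profile R n m) : pattern :=
  [ffun ij : 'I_N * 'I_m => `[< sold (price ij.1) ij.2 v >]].

Definition pattern_profile (t : pattern) : profile R n m :=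
  xget [tuple zero_valuation R m | i < n] (sale_pattern @^-1` [set t]).

Definition pattern_weight (t : pattern) : R := fine (D (sale_pattern @^-1` [set t])).

(** Read off a representative profile and not from [t ij]: even a pattern attained by no profile
    then describes an actual sale, to which the count of sale patterns applies. *)
Definition pattern_sold (ij : 'I_N * 'I_m) (t : pattern) : bool :=
  `[< sold (price ij.1) ij.2 (pattern_profile t) >].

Lemma pattern_soldE ij v : pattern_sold ij (sale_pattern v) = `[< sold (price ij.1) ij.2 v >].
Proof.
rewrite /pattern_sold /pattern_profile.
have ex : exists u, (sale_pattern @^-1` [set sale_pattern v]) u by exists v.
have /ffunP/(_ ij) := xgetPex [tuple zero_valuation R m | i < n] ex.
by rewrite !ffunE.
Qed.

Lemma measurable_sale_pattern t : measurable (sale_pattern @^-1` [set t]).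
Proof.
rewrite (_ : _ @^-1` _ = \bigcap_(ij in [set: 'I_N * 'I_m])
  (if t ij then sold (price ij.1) ij.2 else ~` sold (price ij.1) ij.2)).
  apply: fin_bigcap_measurable => // ij _; case: ifP => _; last apply: measurableC;
  exact: measurable_sold.
apply/seteqP; split=> v /= => [<- ij _|vt].
  by rewrite ffunE; case: asboolP.
apply/ffunP => ij; rewrite ffunE; have := vt ij I; case: (t ij) => svt.
  exact/asboolP.
exact/asboolPn.
Qed.

Lemma mean_pattern_sold ij :
  mean pattern_weight pattern_sold ij = sale_probR D (price ij.1) ij.2.
Proof.
rewrite /sale_probR /sale_prob.
have -> : sold (price ij.1) ij.2 = [set v | pattern_sold ij (sale_pattern v)].
  apply/seteqP; split=> v /=; rewrite pattern_soldE; first by move/asboolP.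
  by move=> /asboolP.
rewrite finite_law; last exact: measurable_sale_pattern.
rewrite /mean [RHS]big_mkcond; apply: eq_bigr => t _.
by rewrite /pattern_weight; case: ifP => _; rewrite ?mulr1 ?mulr0.
Qed.

Lemma sum_pattern_weight : \sum_t pattern_weight t = 1.
Proof.
have := finite_law D predT measurable_sale_pattern; rewrite /pattern_weight => <-.
rewrite (_ : [set w | _] = setT) ?probability_setT //.
by apply/seteqP; split.
Qed.

Variables (k : nat) (d : measure_display) (Omega : measurableType d).
Variables (P : probability Omega R) (X : 'I_k -> {RV P >-> profile R n m}).
Hypothesis samples : independent_samples D X.

Definition empirical_sales (s : k.-tuple (profile R n m)) (p : 'I_m -> R) j : R :=
  \sum_(l < k) (`[< sold p j (tnth s l) >])%:R.

Definition deviation_event (eps : R) : set Omega :=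
  [set w | exists ij : 'I_N * 'I_m, eps * k%:R <
    `|empirical_sales [tuple X l w | l < k] (price ij.1) ij.2 -
      k%:R * sale_probR D (price ij.1) ij.2|].

Let sample_pattern (w : Omega) : {ffun 'I_k -> pattern} :=
  [ffun l => sale_pattern (X l w)].

Let sample_pattern_preimage x : sample_pattern @^-1` [set x] =
  \bigcap_(l in [set: 'I_k]) (X l @^-1` (sale_pattern @^-1` [set x l])).
Proof.
apply/seteqP; split=> w /= => [<- l _|H] /=; first by rewrite ffunE.
by apply/ffunP => l; rewrite ffunE; exact: (H l I).
Qed.

Let measurable_sample_pattern x : measurable (sample_pattern @^-1` [set x]).
Proof.
rewrite sample_pattern_preimage; apply: fin_bigcap_measurable => // l _.
by rewrite -[X in measurable X]setTI; apply: measurable_funPT => //; exact: measurable_sale_pattern.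
Qed.

Let sample_pattern_law x :
  fine (P (sample_pattern @^-1` [set x])) = sample_weight pattern_weight x.
Proof.
have [law indep] := samples; rewrite sample_pattern_preimage indep; last first.
  by move=> l; exact: measurable_sale_pattern.
rewrite (eq_bigr (fun l => (pattern_weight (x l))%:E)) ?prodEFin // => l _.
have mx := measurable_sale_pattern (x l).
by rewrite law // /pattern_weight fineK // fin_num_measure.
Qed.

Let deviation_eventE eps : deviation_event eps = [set w | [exists ij,
  eps * k%:R < `|hits R pattern_sold ij (sample_pattern w) -
    k%:R * mean pattern_weight pattern_sold ij|]].
Proof.
have same w ij : hits R pattern_sold ij (sample_pattern w) =
    empirical_sales [tuple X l w | l < k] (price ij.1) ij.2.
  by apply: eq_bigr => l _; rewrite ffunE pattern_soldE tnth_mktuple.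
apply/seteqP; split=> w /=.
  by case=> ij dev; apply/existsP; exists ij; rewrite same mean_pattern_sold.
by case/existsP => ij dev; exists ij; move: dev; rewrite same mean_pattern_sold.
Qed.

Lemma measurable_deviation_event eps : measurable (deviation_event eps).
Proof.
rewrite deviation_eventE.
rewrite (_ : [set w | _] = \bigcup_(x in [set x : {ffun 'I_k -> pattern} | [exists ij,
    eps * k%:R < `|hits R pattern_sold ij x - k%:R * mean pattern_weight pattern_sold ij|]])
  (sample_pattern @^-1` [set x])).
  by apply: fin_bigcup_measurable.
by apply/seteqP; split=> [w dev|w [x dev /= wx]]; [exists (sample_pattern w)|rewrite wx].
Qed.

Lemma deviation_event_le (eps delta : R) : (0 < n)%N -> (0 < m)%N -> 0 < eps -> 0 < delta < 1 ->
  18 * (profile_log n m * m)%:R + ln (16 / delta) <= eps ^+ 2 * k%:R / 2048 ->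
  (P (deviation_event eps) <= delta%:E)%E.
Proof.
move=> n0 m0 eps0 d01 large.
rewrite -[X in (X <= _)%E]fineK; last first.
  by rewrite fin_num_measure //; exact: measurable_deviation_event.
rewrite lee_fin deviation_eventE.
rewrite (finite_law P (fun x : {ffun 'I_k -> pattern} => [exists ij,
  eps * k%:R < `|hits R pattern_sold ij x - k%:R * mean pattern_weight pattern_sold ij|])
  measurable_sample_pattern).
under eq_bigr do rewrite sample_pattern_law.
apply: (@finite_uniform_deviation _ _ _ _ _ _ m (profile_log n m)) => //.
- by move=> t; rewrite fine_ge0.
- exact: sum_pattern_weight.
- by rewrite m0 /profile_log; lia.
move=> s z s0; apply: leq_trans (sold_patterns_growth n0 m0 s0).
exact: (card_sold_patterns (pattern_profile \o z) (fun i : 'I_N => price i)).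
Qed.

End UniformSaleDeviation.

(** * Sample size and choice of the prices *)

Lemma up_log_le_ln (R : realType) (n : nat) : (0 < n)%N ->
  (up_log 2 n)%:R <= 1 + 2 * ln n%:R :> R.
Proof.
move=> n0; have [n1|n1] := ltnP 1 n; last first.
  have -> : n = 1%N by apply/eqP; rewrite eqn_leq n1 n0.
  by rewrite up_log1 ln1 mulr0 addr0.
have := up_log_gtn (isT : 1 < 2)%N n1.
set u := up_log 2 n; have u0 : (0 < u)%N by rewrite up_log_gt0.
move=> lt; have e2 : expR (1 / 2) <= 2 :> R.
  rewrite -[expR _]invrK -expRN -[leRHS]invrK lef_pV2 ?posrE ?invr_gt0 ?expR_gt0 //.
  by have := expR_ge1Dx (- (1 / 2) : R); lra.
have : u.-1%:R / 2 <= ln n%:R :> R.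
  rewrite -ler_expR lnK ?posrE ?ltr0n // -[_ / 2]mulr1 -mulrA [2^-1 * 1]mulrC expRM_natl.
  apply: (@le_trans _ _ (2 ^ u.-1)%N%:R); last by rewrite ler_nat ltnW.
  by rewrite natrX lerXn2r ?nnegrE ?expR_ge0.
have -> : u%:R = u.-1%:R + 1 :> R by rewrite natr1 prednK.
lra.
Qed.

(** The factor 16 comes from (eps/4)^2, and 106 = 18 * 5 + 16 from [profile_log n m * m] <= 5 m^2 +
    2 m ln n and ln 16 <= 16 m^2. *)
Lemma sample_size_bound (R : realType) (n m k : nat) (eps delta : R) :
  (0 < n)%N -> (0 < m)%N -> 0 < eps -> 0 < delta < 1 ->
  2048 * 16 * 106 / eps ^+ 2 * (m%:R ^+ 2 + m%:R * ln n%:R + ln (1 / delta)) <= k%:R ->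
  18 * (profile_log n m * m)%:R + ln (16 / delta) <= (eps / 4) ^+ 2 * k%:R / 2048.
Proof.
move=> n0 m0 eps0 /andP[d0 d1].
rewrite mulrAC ler_pdivrMr ?exprn_gt0 // => large.
have m1 : 1 <= m%:R :> R by rewrite ler1n.
have ln_n : 0 <= ln n%:R :> R by rewrite ln_ge0 // ler1n.
have ln_d : 0 <= ln (1 / delta) by rewrite ln_ge0 // ler_pdivlMr // mul1r ltW.
have -> : 16 / delta = 16 * (1 / delta) by field; rewrite gt_eqF.
rewrite lnM ?posrE ?divr_gt0 //.
have ln16 : ln 16 <= 16 :> R by apply/ltW/ln_sublinear.
have u := @up_log_le_ln R n n0.
have hE : (profile_log n m * m)%:R = (2 * m%:R + 2 + (up_log 2 n)%:R) * m%:R :> R.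
  by rewrite natrM /profile_log natrD natrD natrM.
have hm : (profile_log n m * m)%:R <= 5 * m%:R ^+ 2 + 2 * (m%:R * ln n%:R) :> R.
  by rewrite hE; nra.
have m2 : 1 <= m%:R ^+ 2 :> R by nra.
have mln : 0 <= m%:R * ln n%:R :> R by rewrite mulr_ge0.
have -> : (eps / 4) ^+ 2 * k%:R / 2048 = k%:R * eps ^+ 2 / (2048 * 16) by field.
have c0 : 0 < 2048 * 16 :> R by rewrite mulr_gt0 ?ltr0n.
rewrite (ler_pdivlMr _ _ c0); apply: le_trans large.
move: (m%:R ^+ 2) (m%:R * ln n%:R) (ln (1 / delta)) m2 mln ln_d hm => a b c.
move: ((profile_log n m * m)%:R) (ln 16) ln16 => e f; lra.
Qed.

Section Prices.
Variables (R : realType) (m : nat).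

(** The grid prices of all meshes as one sequence; an index that encodes no grid point stands for
    the zero price. *)
Definition enum_price (idx : nat) : 'I_m.+1 -> R :=
  if @unpickle (nat * {ffun 'I_m.+1 -> nat})%type idx is Some (M, x)
  then grid_price R M x else fun=> 0.

Lemma enum_price_ge0 idx : price_vector (enum_price idx).
Proof.
rewrite /enum_price; case: unpickle => [[M x]|]; first exact: grid_price_ge0.
by move=> j.
Qed.

Lemma enum_price_pickle M x : enum_price (pickle (M, x)) = grid_price R M x.
Proof. by rewrite /enum_price pickleK. Qed.

Variables (n k : nat).

Definition empirical_median (eps : R) (s : k.-tuple (profile R n m.+1))
    (p : 'I_m.+1 -> R) : Prop :=
  forall j, empirical_sales s p j <= (1 / 2 + eps) * k%:R /\
    (0 < p j -> (1 / 2 - eps) * k%:R <= empirical_sales s p j).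

(** The default zero price is never reached on the good event, where some grid price qualifies. *)
Definition median_procedure (eps : R) (s : k.-tuple (profile R n m.+1)) : 'I_m.+1 -> R :=
  if pselect (exists idx, empirical_median eps s (enum_price idx)) is left found
  then enum_price (projT1 (cid found)) else fun=> 0.

Lemma median_procedure_ge0 eps s : price_vector (median_procedure eps s).
Proof.
rewrite /median_procedure; case: pselect => [found|_ j] //.
exact: enum_price_ge0.
Qed.

Lemma median_procedureP eps s idx : empirical_median eps s (enum_price idx) ->
  exists2 idx', median_procedure eps s = enum_price idx' &
    empirical_median eps s (enum_price idx').
Proof.
move=> found; rewrite /median_procedure; case: pselect => [ex|[]]; last by exists idx.
by exists (projT1 (cid ex)) => //; exact: (projT2 (cid ex)).
Qed.

End Prices.

Theorem theorem4p6 (R : realType) :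
  exists C : R,
  forall (n m : nat) (eps delta : R) (k : nat),
    (1 <= n)%N -> (1 <= m)%N -> 0 < eps < 1 / 2 -> 0 < delta < 1 ->
    C / eps ^+ 2 * (m%:R ^+ 2 + m%:R * ln n%:R + ln (1 / delta)) <= k%:R ->
    exists2 A : k.-tuple (profile R n m) -> 'I_m -> R,
      forall s, price_vector (A s) &
      forall D : probability (profile R n m) R, generic_profile D ->
      forall (d : measure_display) (Omega : measurableType d)
        (P : probability Omega R) (X : 'I_k -> {RV P >-> profile R n m}),
        independent_samples D X ->
        holds_with_prob P (1 - delta)
          [set w | median_prices D (1 / 2 - eps) (A [tuple X l w | l < k])].
Proof.
exists (2048 * 16 * 106) => n [//|m] eps delta k n0 m0 /andP[eps0 _] d01 large.
have large' := sample_size_bound n0 m0 eps0 d01 large.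
have k0 : 0 < k%:R :> R.
  rewrite lt_neqAle ler0n andbT eq_sym; apply: contraTneq large' => ->.
  rewrite mulr0 mul0r -ltNge; apply: ltr_pwDl.
    by rewrite mulr_gt0 ?ltr0n // muln_gt0 m0 andbT /profile_log; lia.
  by case/andP: d01 => d0 d1; rewrite ln_ge0 // ler_pdivlMr //; lra.
(* An eps/2-approximate median passes the empirical test with eps/2 + eps/4; whatever passes is off
   by at most another eps/4. *)
exists (median_procedure (3 / 4 * eps)); first exact: median_procedure_ge0.
move=> D gen d Omega P X samples.
have eps4 : 0 < eps / 4 by rewrite divr_gt0.
pose bad N := deviation_event D (@enum_price R m) N X (eps / 4).
have mbad N : measurable (bad N) by exact: measurable_deviation_event.
have mU : measurable (\bigcup_N bad N) by exact: bigcup_measurable.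
(* The events increase with N and obey the same bound. *)
have bad_le : (P (\bigcup_N bad N) <= delta%:E)%E.
  have cvg_bad : P \o bad @ \oo --> P (\bigcup_N bad N).
    apply: nondecreasing_cvg_mu => // a b ab; apply/subsetPset => w [[i j] dev].
    by exists (widen_ord ab i, j).
  rewrite -(cvg_lim (@ereal_hausdorff R) cvg_bad).
  apply: lime_le; first by apply/cvg_ex; exists (P (\bigcup_N bad N)).
  by near=> N; exact: deviation_event_le.
exists (~` \bigcup_N bad N); split; first exact: measurableC.
- move=> w good /=; pose s := [tuple X l w | l < k].
  have close idx j : `|empirical_sales s (enum_price R idx) j -
      k%:R * sale_probR D (enum_price R idx) j| <= eps / 4 * k%:R.
    (* The price of index [idx] is the last of the first [idx.+1]. *)
    rewrite leNgt; apply/negP => dev; apply: good; exists idx.+1 => //.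
    by exists (ord_max, j).
  have eps2 : 0 < eps / 2 by rewrite divr_gt0.
  have [M [x median]] := exists_approx_median gen eps2.
  have : empirical_median (3 / 4 * eps) s (enum_price R (pickle (M, x))).
    move=> j; have := close (pickle (M, x)) j; have := median j.
    rewrite enum_price_pickle ler_norml => -[hi lo] /andP[c1 c2]; split=> [|/lo {}lo]; nra.
  case/median_procedureP => idx eq_p emp; rewrite -/s eq_p.
  split=> [|j|j pj]; first exact: enum_price_ge0.
    rewrite -sale_probRE lee_fin -(ler_pM2r k0).
    by have := close idx j; have [hi _] := emp j; rewrite ler_norml => /andP[c1 c2]; nra.
  rewrite -sale_probRE lee_fin -(ler_pM2r k0).
  by have := close idx j; have [_ /(_ pj) lo] := emp j; rewrite ler_norml => /andP[c1 c2]; nra.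
by rewrite probability_setC // EFinB leeB.
Unshelve. all: by end_near. Qed.
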